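(* Let $R$ be an associative ring with identity. The map $[T]\mapsto \overline{\mathcal{X}_T}$, where $\overline{\mathcal{X}_T}=T^{\perp}\cap \mathrm{Gen}^*(T)$, is a well-defined one-to-one correspondence (bijection) between (a) the equivalence classes, under the relation $\sim$, of Wakamatsu tilting right $R$-modules; and (b) the preenveloping $\overline{\text{coresolving}}$ subcategories $\mathcal{C}$ of $\mathrm{Mod}\text{-}R$ that possess an Ext-projective $\overline{\text{generator}}$ $T$ lying in $\mathrm{gen}^*(R)$ and that are maximal (with respect to inclusion) among the preenveloping $\overline{\text{coresolving}}$ subcategories of $\mathrm{Mod}\text{-}R$ having the same Ext-projective $\overline{\text{generator}}$ $T$.
   Context: Rings are associative with identity and modules are unitary. $\mathrm{Mod}\text{-}R$ is the category of all right $R$-modules. Subcategories are understood to be full and closed under isomorphism (i.e. classes of modules). $\mathrm{Add}(T)$ (resp. $\mathrm{add}(T)$) is the class of right $R$-modules isomorphic to a direct summand of a direct sum of copies (resp. finitely many copies) of $T$. $\mathrm{Gen}^*(T)$ (resp. $\mathrm{gen}^*(T)$) is the class of right $R$-modules $M$ for which there is an exact sequence $\cdots\to T_1\xrightarrow{f_1}T_0\xrightarrow{f_0}M\to 0$ with all $T_i\in\mathrm{Add}(T)$ (resp. $\mathrm{add}(T)$) and $\mathrm{Ext}^1_R(T,\mathrm{Ker} f_i)=0$ for all $i\ge 0$. $\mathrm{cogen}^*(T)$ is the class of right $R$-modules $M$ for which there is an exact sequence $0\to M\xrightarrow{f^{-1}}T^0\xrightarrow{f^0}T^1\xrightarrow{f^1}\cdots$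 with all $T^i\in\mathrm{add}(T)$ and $\mathrm{Ext}^1_R(\mathrm{Coker} f^i,T)=0$ for all $i\ge -1$. $T^{\perp}=\{M : \mathrm{Ext}^i_R(T,M)=0 \text{ for all } i\ge 1\}$; for a class $\mathcal{C}$, ${}^{\perp}\mathcal{C}=\{M: \mathrm{Ext}^i_R(M,X)=0\text{ for all }X\in\mathcal{C}, i\ge1\}$. A right $R$-module $T$ is Wakamatsu tilting if $\mathrm{Ext}^i_R(T,T)=0$ for all $i\ge 1$, $T\in\mathrm{gen}^*(R)$ and $R_R\in\mathrm{cogen}^*(T)$. Invertible bimodules: an $(S,S')$-bimodule $P$ is invertible if $P\otimes_{S'}-:S'\text{-Mod}\to S\text{-Mod}$ is an equivalence of categories. Relation $\sim$: for right $R$-modules $T,T'$ with $S=\mathrm{End}(T_R)$, $S'=\mathrm{End}(T'_R)$ (so $T$ is an $(S,R)$-bimodule and $T'$ an $(S',R)$-bimodule), $T\sim T'$ iff there are invertible bimodules ${}_SP_{S'}$ and ${}_{S'}Q_S$ with $T\cong P\otimes_{S'}T'$ and $T'\cong Q\otimes_S T$ as right $R$-modules. This is an equivalence relation; $[T]$ is the class of $T$. A subcategory $\mathcal{C}$ of $\mathrm{Mod}\text{-}R$ is $\overline{\text{coresolving}}$ if it is closed under direct summands, extensions and cokernels of monomorphisms and contains all injective right $R$-modules. It is preenveloping if every right $R$-module $M$ admits a homomorphism $\phi:M\to C_M$ with $C_M\in\mathcal{C}$ such that $\mathrm{Hom}_R(C_M,C)\to\mathrm{Hom}_R(M,C)$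 is surjective for all $C\in\mathcal{C}$. A module $T\in\mathcal{C}$ is an Ext-projective $\overline{\text{generator}}$ for $\mathcal{C}$ if $T\in{}^{\perp}\mathcal{C}$ and for every $M\in\mathcal{C}$ there is an exact sequence $0\to M'\to T'\to M\to 0$ with $T'\in\mathrm{Add}(T)$ and $M'\in\mathcal{C}$. *)

(* Defs.v *)
From HB Require Import structures.
From mathcomp Require Import all_boot all_algebra.
From mathcomp Require Import boolp classical_sets functions cardinality.
From mathcomp Require Import finmap.
From mathcomp.multinomials Require Import freeg.

Set Implicit Arguments.
Unset Strict Implicit.
Unset Printing Implicit Defensive.

Import GRing.Theory.
Local Open Scope ring_scope.

(* A right R-module is a left module over the converse ring R^c: for          *)
(* r : R^c and x : M, r *: x is x r.  Everything that does not mention        *)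
(* bimodules is written for left modules over an arbitrary ring A and is used *)
(* with A := R^c.                                                             *)
Notation rmodType R := (lmodType R^c).

Section Constructions.
Variable A : pzRingType.

Definition isomorphic (U V : lmodType A) : Prop :=
  exists f : {linear U -> V}, bijective f.

Definition exact_at (U V W : lmodType A)
    (f : {linear U -> V}) (g : {linear V -> W}) : Prop :=
  forall y, g y = 0 <-> exists x, f x = y.

Definition surj (U V : lmodType A) (f : {linear U -> V}) : Prop :=
  forall y, exists x, f x = y.

Definition short_exact (U V W : lmodType A)
    (f : {linear U -> V}) (g : {linear V -> W}) : Prop :=
  [/\ injective f, exact_at f g & surj g].

Section Kernel.
Variables (U V : lmodType A) (f : {linear U -> V}).

Definition ker_pred : {pred U} := fun x => f x == 0.

Fact ker_pred_closed : subsemimod_closed ker_pred.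
Proof.
split; first split; rewrite ?unfold_in /ker_pred ?linear0 //.
- by move=> x y; rewrite !unfold_in /ker_pred linearD => /eqP-> /eqP->; rewrite addr0.
- by move=> a x; rewrite !unfold_in /ker_pred linearZ /= => /eqP->; rewrite scaler0.
Qed.

HB.instance Definition _ := GRing.isSubmodClosed.Build A U ker_pred ker_pred_closed.

Record kernel : Type := Kernel { kernel_val :> U; _ : kernel_val \in ker_pred }.

HB.instance Definition _ := [isSub for kernel_val].
HB.instance Definition _ := [Choice of kernel by <:].
HB.instance Definition _ := [SubChoice_isSubLmodule of kernel by <:].

End Kernel.

Section Cokernel.
Variables (U V : lmodType A) (f : {linear U -> V}).

Definition im_pred : {pred V} := fun y => `[< exists x, f x = y >].

Fact im_pred_closed : subsemimod_closed im_pred.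
Proof.
split; first split; rewrite ?unfold_in /im_pred.
- by apply/asboolP; exists 0; rewrite linear0.
- move=> _ _ /asboolP[x <-] /asboolP[y <-].
  by apply/asboolP; exists (x + y); rewrite linearD.
- move=> a _ /asboolP[x <-].
  by apply/asboolP; exists (a *: x); rewrite linearZ.
Qed.

HB.instance Definition _ := GRing.isSubmodClosed.Build A V im_pred im_pred_closed.

Definition cokernel : Type := Quotient.quot im_pred.
HB.instance Definition _ := GRing.Zmodule.on cokernel.

Local Open Scope quotient_scope.

Definition coker_proj (y : V) : cokernel := \pi_(Quotient.quot im_pred) y.

Fact coker_projD : {morph coker_proj : x y / x + y}.
Proof. exact: Quotient.pi_add. Qed.

Fact coker_projP x y : coker_proj x = coker_proj y <-> exists u, f u = x - y.
Proof.
rewrite /coker_proj; split=> [/eqP|[u fu]]; last apply/eqP; rewrite -Quotient.idealrBE.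
- by move=> /asboolP.
- by apply/asboolP; exists u.
Qed.

Fact coker_proj_surj (q : cokernel) : exists y, coker_proj y = q.
Proof. by exists (repr (q : Quotient.quot im_pred)); exact: reprK. Qed.

Definition coker_scale (a : A) (q : cokernel) : cokernel :=
  coker_proj (a *: repr (q : Quotient.quot im_pred)).

Fact coker_projZ a y : coker_scale a (coker_proj y) = coker_proj (a *: y).
Proof.
have /coker_projP[u fu] : coker_proj (repr (coker_proj y : Quotient.quot im_pred)) = coker_proj y.
  exact: reprK.
by apply/coker_projP; exists (a *: u); rewrite linearZ /= fu scalerBr.
Qed.

Fact coker_scaleA a b q : coker_scale a (coker_scale b q) = coker_scale (a * b) q.
Proof. by have [y <-] := coker_proj_surj q; rewrite !coker_projZ scalerA. Qed.

Fact coker_scale1 : left_id 1 coker_scale.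
Proof. by move=> q; have [y <-] := coker_proj_surj q; rewrite coker_projZ scale1r. Qed.

Fact coker_scaleDr : right_distributive coker_scale +%R.
Proof.
move=> a q r; have [x <-] := coker_proj_surj q; have [y <-] := coker_proj_surj r.
by rewrite -coker_projD !coker_projZ scalerDr coker_projD.
Qed.

Fact coker_scaleDl q : {morph coker_scale^~ q : a b / a + b}.
Proof.
by move=> a b; have [y <-] := coker_proj_surj q; rewrite !coker_projZ scalerDl coker_projD.
Qed.

HB.instance Definition _ := GRing.Zmodule_isLmodule.Build A cokernel
  coker_scaleA coker_scale1 coker_scaleDr coker_scaleDl.

Fact coker_proj_linear : linear coker_proj.
Proof. by move=> a x y; rewrite coker_projD -coker_projZ. Qed.

HB.instance Definition _ :=
  GRing.isLinear.Build A V cokernel _ coker_proj coker_proj_linear.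

End Cokernel.

(* The direct sum of copies of M indexed by I: finitely supported functions. *)
Section DirectSum.
Variables (I : Type) (M : lmodType A).

Definition finsupp : {pred (I -> M)} :=
  fun f => `[< finite_set [set i | f i <> 0]%classic >].

Fact finsupp_closed : subsemimod_closed finsupp.
Proof.
split; first split; rewrite ?unfold_in /finsupp.
- by apply/asboolP; rewrite (_ : mkset _ = set0) // -subset0 => i /=.
- move=> f g /asboolP hf /asboolP hg; apply/asboolP.
  apply: sub_finite_set (_ : finite_set ([set i | f i <> 0] `|` [set i | g i <> 0])%classic).
  + move=> i /= fgi; have [fi0|] := pselect (f i = 0); last by left.
    by right=> gi0; apply: fgi; rewrite /= /GRing.add /= fi0 gi0 addr0.
  + by rewrite finite_setU.
- move=> a f /asboolP hf; apply/asboolP; apply: sub_finite_set hf.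
  by move=> i /= afi fi0; apply: afi; rewrite /GRing.scale /= fi0 scaler0.
Qed.

HB.instance Definition _ :=
  GRing.isSubmodClosed.Build A (I -> M) finsupp finsupp_closed.

Record dsum : Type := DSum { dsum_fun :> I -> M; _ : dsum_fun \in finsupp }.

HB.instance Definition _ := [isSub for dsum_fun].
HB.instance Definition _ := [Choice of dsum by <:].
HB.instance Definition _ := [SubChoice_isSubLmodule of dsum by <:].

End DirectSum.

Definition summand (M N : lmodType A) : Prop :=
  exists M' : lmodType A, isomorphic (M * M')%type N.

Definition Add (T M : lmodType A) : Prop :=
  exists I : Type, summand M (dsum I T).

Definition add (T M : lmodType A) : Prop :=
  exists n : nat, summand M (dsum 'I_n T).

Definition projective (P : lmodType A) : Prop :=
  forall (U V : lmodType A) (g : {linear U -> V}) (h : {linear P -> V}),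
    surj g -> exists k : {linear P -> U}, forall x, g (k x) = h x.

Definition injective_module (E : lmodType A) : Prop :=
  forall (U V : lmodType A) (f : {linear U -> V}) (h : {linear U -> E}),
    injective f -> exists k : {linear V -> E}, forall x, k (f x) = h x.

(* ... -> P 1 -> P 0 -> M -> 0 *)
Record resolution (M : lmodType A) := Resolution {
  res_obj :> nat -> lmodType A;
  res_aug : {linear res_obj 0%N -> M};
  res_d : forall n, {linear res_obj n.+1 -> res_obj n};
  res_surj : surj res_aug;
  res_exact0 : exact_at (res_d 0%N) res_aug;
  res_exactS : forall n, exact_at (res_d n.+1) (res_d n)
}.

(* With f_0 = res_aug and f_(n+1) = res_d n, this is Ker f_n. *)
Definition res_ker (M : lmodType A) (P : resolution M) (n : nat) : lmodType A :=
  if n is m.+1 then kernel (res_d P m) else kernel (res_aug P).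

(* 0 -> M -> C 0 -> C 1 -> ... *)
Record coresolution (M : lmodType A) := Coresolution {
  cores_obj :> nat -> lmodType A;
  cores_aug : {linear M -> cores_obj 0%N};
  cores_d : forall n, {linear cores_obj n -> cores_obj n.+1};
  cores_inj : injective cores_aug;
  cores_exact0 : exact_at cores_aug (cores_d 0%N);
  cores_exactS : forall n, exact_at (cores_d n) (cores_d n.+1)
}.

(* With f^(-1) = cores_aug and f^n = cores_d n, this is Coker f^(n-1). *)
Definition cores_coker (M : lmodType A) (C : coresolution M) (n : nat) : lmodType A :=
  if n is m.+1 then cokernel (cores_d C m) else cokernel (cores_aug C).

Section Ext.
Variables (M N : lmodType A) (P : resolution M).

Definition cocycle n (f : {linear P n -> N}) : Prop :=
  forall x, f (res_d P n x) = 0.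

Definition coboundary n : {linear P n -> N} -> Prop :=
  if n is m.+1
  then fun f => exists g : {linear P m -> N}, forall x, f x = g (res_d P m x)
  else fun f => forall x, f x = 0.

End Ext.

(* Ext^n(M, N) = 0: the n-th cohomology group of Hom(P, N) is zero for P a    *)
(* projective resolution of M (one exists, see projective_resolution below).  *)
Definition Ext_zero (n : nat) (M N : lmodType A) : Prop :=
  forall P : resolution M, (forall i, projective (P i)) ->
  forall f : {linear P n -> N}, cocycle f -> coboundary f.

End Constructions.

Section ProjectiveResolution.
Variable A : pzRingType.

Section Lift.
Variables (I : choiceType) (N : lmodType A) (phi : I -> N).

Definition dsum_lift (f : dsum I A^o) : N :=
  \sum_(i <- fset_set [set i | f i <> 0]%classic) (f i : A) *: phi i.

Let finsuppP (f : dsum I A^o) : finite_set [set i | f i <> 0]%classic.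
Proof. by apply/asboolP; exact: (valP f). Qed.

Let dsum_liftE (f : dsum I A^o) (s : {fset I}) :
  (forall i, f i <> 0 -> i \in s) -> dsum_lift f = \sum_(i <- s) (f i : A) *: phi i.
Proof.
move=> fs; rewrite /dsum_lift.
rewrite [RHS](bigID (fun i => f i != 0)) /= [X in _ + X]big1 ?addr0; last first.
  by move=> i; rewrite negbK => /eqP->; rewrite scale0r.
rewrite -[RHS]big_filter; apply: perm_big; apply: uniq_perm.
- exact: fset_uniq.
- exact/filter_uniq/fset_uniq.
- move=> i; rewrite mem_filter in_fset_set //; apply/idP/andP => [|[/eqP fi _]].
  + by move=> /set_mem /= fi; split; [exact/eqP | exact: fs].
  + by rewrite mem_set.
Qed.

Fact dsum_lift_linear : linear dsum_lift.
Proof.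
move=> a f g.
pose s := (fset_set [set i | f i <> 0%R]%classic `|` fset_set [set i | g i <> 0%R]%classic)%fset.
have fs i : f i <> 0 -> i \in s by move=> fi; rewrite in_fsetU in_fset_set // mem_set.
have gs i : g i <> 0 -> i \in s.
  by move=> gi; rewrite in_fsetU [X in _ || X]in_fset_set // orbC mem_set.
rewrite (dsum_liftE fs) (dsum_liftE gs) (@dsum_liftE _ s).
  rewrite scaler_sumr -big_split; apply: eq_bigr => i _ /=.
  by rewrite scalerA -scalerDl.
move=> i; have [fi|] := pselect (f i = 0); last by move/fs.
have [gi|] := pselect (g i = 0); last by move/gs.
have -> : (a *: f + g) i = a * (f i : A) + (g i : A) by [].
by rewrite fi gi mulr0 addr0.
Qed.

HB.instance Definition _ :=
  GRing.isLinear.Build A (dsum I A^o) N _ dsum_lift dsum_lift_linear.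

Fact dirac_finsupp (i : I) : (fun j => (j == i)%:R : A^o) \in @finsupp A I A^o.
Proof.
apply/asboolP; apply: sub_finite_set (finite_set1 i) => j /=.
by case: eqP => // _ /(_ erefl).
Qed.

Definition dirac (i : I) : dsum I A^o := DSum (dirac_finsupp i).

Fact dsum_lift_dirac i : dsum_lift (dirac i) = phi i.
Proof.
rewrite (@dsum_liftE _ [fset i]%fset) ?big_seq_fset1 /= ?eqxx ?scale1r // => j /=.
by rewrite in_fset1; case: eqP => // _ /(_ erefl).
Qed.

End Lift.

Fact dsum_liftK (I : choiceType) (N : lmodType A) (h : {linear dsum I A^o -> N}) f :
  h f = dsum_lift (fun i => h (dirac i)) f.
Proof.
rewrite {1}(_ : f = \sum_(i <- fset_set [set i | f i <> 0]%classic) (f i : A) *: dirac i).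
  by rewrite linear_sum; apply: eq_bigr => i _; rewrite linearZ.
apply: val_inj; rewrite /= [RHS](raddf_sum (val : dsum I A^o -> (I -> A^o))) /=.
rewrite fct_sumE; apply: funext => j.
have ff : finite_set [set i | f i <> 0]%classic by apply/asboolP; exact: (valP f).
have [fj|fj] := pselect (f j = 0).
  rewrite [LHS]fj big_seq big1 // => i; rewrite in_fset_set // => /set_mem /= fi.
  rewrite /GRing.scale /= /GRing.scale /=; case: eqP => [ji|]; rewrite ?mulr0 //.
  by case: fi; rewrite -ji.
rewrite (big_fsetD1 j) /=; last by rewrite in_fset_set // mem_set.
rewrite [X in X + _]/GRing.scale /= [X in X + _]/GRing.scale /= eqxx mulr1.
rewrite big_seq big1 ?addr0 // => i; rewrite !inE => /andP[ij _].
by rewrite /GRing.scale /= /GRing.scale /= eq_sym (negPf ij) mulr0.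
Qed.

Fact dsum_projective (I : choiceType) : projective (dsum I A^o).
Proof.
move=> U V g h g_surj.
have [phi phiP] := @choice _ _ (fun i u => g u = h (dirac i)) (fun i => g_surj _).
exists (dsum_lift phi) => f; rewrite [RHS]dsum_liftK /dsum_lift linear_sum.
by apply: eq_bigr => i _; rewrite linearZ /= phiP.
Qed.

Definition cover (M : lmodType A) : lmodType A := dsum M A^o.
Definition cover_map (M : lmodType A) : {linear cover M -> M} := @dsum_lift M M idfun.

Fact cover_surj M : surj (@cover_map M).
Proof. by move=> x; exists (dirac x); exact: dsum_lift_dirac. Qed.

Fixpoint syzygy (M : lmodType A) (n : nat) : lmodType A :=
  if n is m.+1 then kernel (@cover_map (syzygy M m)) else M.

Definition cover_d (M : lmodType A) n :
    {linear cover (syzygy M n.+1) -> cover (syzygy M n)} :=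
  (val : kernel (@cover_map (syzygy M n)) -> _) \o @cover_map (syzygy M n.+1).

Fact cover_exact M n : exact_at (cover_d M n) (@cover_map (syzygy M n)).
Proof.
move=> y; split=> [y0|[x <-]]; last first.
  pose z : kernel (@cover_map (syzygy M n)) := @cover_map (syzygy M n.+1) x.
  exact/eqP/(valP z).
have yk : y \in ker_pred (@cover_map (syzygy M n)) by apply/eqP.
have [x xE] := @cover_surj (syzygy M n.+1) (Kernel yk).
by exists x; exact: (congr1 (@kernel_val _ _ _ (@cover_map (syzygy M n))) xE).
Qed.

Fact projective_resolution (M : lmodType A) :
  exists P : resolution M, forall i, projective (P i).
Proof.
have exS n : exact_at (cover_d M n.+1) (cover_d M n).
  move=> y; rewrite -(@cover_exact M n.+1 y); split=> [y0|y0].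
  - by apply: (@val_inj _ _ (kernel (@cover_map (syzygy M n)))); rewrite linear0.
  - have -> : cover_d M n y = val (0 : kernel (@cover_map (syzygy M n))).
      exact: (congr1 (@kernel_val _ _ _ (@cover_map (syzygy M n))) y0).
    exact: linear0.
exists (Resolution (@cover_surj M) (@cover_exact M 0%N) exS) => i.
exact: dsum_projective.
Qed.

End ProjectiveResolution.

Fact linear_ext (A : pzRingType) (U V : lmodType A) (f g : {linear U -> V}) :
  f =1 g -> f = g.
Proof.
case: f g => [f [[f1] [f2]]] [g [[g1] [g2]]] /= /funext fg.
case: _ / fg in g1 g2 *.
by rewrite (Prop_irrelevance f1 g1) (Prop_irrelevance f2 g2).
Qed.

(* The endomorphism ring of M; f * g is the composite f \o g. *)
Section Endomorphisms.
Variables (A : pzRingType) (M : lmodType A).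

Definition endo : Type := {linear M -> M}.

HB.instance Definition _ := gen_eqMixin endo.
HB.instance Definition _ := gen_choiceMixin endo.

Implicit Types f g : {linear M -> M}.
Definition endo_zero : endo := (\0 : {linear M -> M}).
Definition endo_opp f : endo := (\- f : {linear M -> M}).
Definition endo_add f g : endo := (f \+ g : {linear M -> M}).
Definition endo_one : endo := (idfun : {linear M -> M}).
Definition endo_mul f g : endo := (f \o g : {linear M -> M}).

Fact endo_addA : associative (endo_add : endo -> endo -> endo).
Proof. by move=> f g h; apply: linear_ext => x /=; rewrite addrA. Qed.
Fact endo_addC : commutative (endo_add : endo -> endo -> endo).
Proof. by move=> f g; apply: linear_ext => x /=; rewrite addrC. Qed.
Fact endo_add0 : left_id endo_zero (endo_add : endo -> endo -> endo).
Proof. by move=> f; apply: linear_ext => x /=; rewrite add0r. Qed.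
Fact endo_addN : left_inverse endo_zero (endo_opp : endo -> endo) endo_add.
Proof. by move=> f; apply: linear_ext => x /=; rewrite addNr. Qed.

HB.instance Definition _ :=
  GRing.isZmodule.Build endo endo_addA endo_addC endo_add0 endo_addN.

Fact endo_mulA : associative (endo_mul : endo -> endo -> endo).
Proof. by move=> f g h; apply: linear_ext => x. Qed.
Fact endo_mul1 : left_id endo_one (endo_mul : endo -> endo -> endo).
Proof. by move=> f; apply: linear_ext => x. Qed.
Fact endo_1mul : right_id endo_one (endo_mul : endo -> endo -> endo).
Proof. by move=> f; apply: linear_ext => x. Qed.
Fact endo_mulDl : left_distributive (endo_mul : endo -> endo -> endo) +%R.
Proof. by move=> f g h; apply: linear_ext => x. Qed.
Fact endo_mulDr : right_distributive (endo_mul : endo -> endo -> endo) +%R.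
Proof. by move=> f g h; apply: linear_ext => x /=; rewrite linearD. Qed.

HB.instance Definition _ := GRing.Zmodule_isPzRing.Build endo
  endo_mulA endo_mul1 endo_1mul endo_mulDl endo_mulDr.

End Endomorphisms.

(* An (A, B)-bimodule: a right B-module with a commuting left A-action. *)
Record bimodule (A B : pzRingType) := Bimodule {
  bimod_r :> rmodType B;
  lact : A -> bimod_r -> bimod_r;
  lactA : forall a b x, lact a (lact b x) = lact (a * b) x;
  lact1 : forall x, lact 1 x = x;
  lactDr : forall a x y, lact a (x + y) = lact a x + lact a y;
  lactDl : forall a b x, lact (a + b) x = lact a x + lact b x;
  lactZ : forall a (b : B^c) x, lact a (b *: x) = b *: lact a x
}.

Section Bimodule.
Variables (A B : pzRingType) (P : bimodule A B).

Fact lact_linear (a : A) : linear (lact a : P -> P).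
Proof. by move=> b x y; rewrite lactDr lactZ. Qed.
HB.instance Definition _ (a : A) :=
  GRing.isLinear.Build B^c P P _ (lact a : P -> P) (lact_linear a).

Definition bimod_left : Type := P.
HB.instance Definition _ := GRing.Zmodule.on bimod_left.

Fact bimod_left_scaleDl (x : bimod_left) :
  {morph (fun a => lact a x : bimod_left) : a b / a + b}.
Proof. by move=> a b; exact: lactDl. Qed.

HB.instance Definition _ := GRing.Zmodule_isLmodule.Build A bimod_left
  (@lactA A B P) (@lact1 A B P) (@lactDr A B P) bimod_left_scaleDl.

Definition bimod_l : lmodType A := bimod_left.

Definition right_mul (b : B^c) : bimod_l -> bimod_l := fun x => b *: (x : P).
Fact right_mul_linear b : linear (right_mul b).
Proof.
move=> a x y; rewrite /right_mul.
have -> : b *: (a *: x + y : P) = b *: (lact a x) + b *: (y : P) by exact: scalerDr.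
by rewrite -lactZ.
Qed.
HB.instance Definition _ (b : B^c) :=
  GRing.isLinear.Build A bimod_l bimod_l _ (right_mul b) (right_mul_linear b).

End Bimodule.

Definition endo_bimod (R : pzRingType) (T : rmodType R) : bimodule (endo T) R :=
  @Bimodule (endo T) R T (fun f x => (f : {linear T -> T}) x)
    (fun f g x => erefl) (fun x => erefl)
    (fun f => linearD (f : {linear T -> T}))
    (fun f g x => erefl)
    (fun f => linearZ_LR (f : {linear T -> T})).

(* The tensor product of X and Y over B: the free abelian group on X * Y      *)
(* modulo the subgroup generated by the relations tensor_rel.                 *)
Section Tensor.
Variables (B : pzRingType) (X : rmodType B) (Y : lmodType B).
Local Notation F := {freeg (X * Y)%type}.

Inductive tensor_rel : F -> Prop :=
| TensorDl x x' y : tensor_rel (<<(x + x', y)>> - (<<(x, y)>> + <<(x', y)>>))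
| TensorDr x y y' : tensor_rel (<<(x, y + y')>> - (<<(x, y)>> + <<(x, y')>>))
| TensorZ (b : B) x y :
    tensor_rel (<<((b : B^c) *: x, y)>> - <<(x, b *: y)>>).

Inductive tensor_gen : F -> Prop :=
| TensorRel u : tensor_rel u -> tensor_gen u
| Tensor0 : tensor_gen 0
| TensorB u v : tensor_gen u -> tensor_gen v -> tensor_gen (u - v).

Definition tensor_null : {pred F} := fun u => `[< tensor_gen u >].

Fact tensor_null_closed : zmod_closed tensor_null.
Proof.
split; first exact/asboolP/Tensor0.
by move=> u v /asboolP hu /asboolP hv; apply/asboolP; exact: TensorB.
Qed.

HB.instance Definition _ := GRing.isZmodClosed.Build F tensor_null tensor_null_closed.

Definition tensor : Type := Quotient.quot tensor_null.
HB.instance Definition _ := GRing.Zmodule.on tensor.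

Local Open Scope quotient_scope.

Definition tensor_pi (u : F) : tensor := \pi_(Quotient.quot tensor_null) u.

Definition pure (x : X) (y : Y) : tensor := tensor_pi <<(x, y)>>.

Fact tensor_piB : {morph tensor_pi : u v / u - v}.
Proof.
by move=> u v; rewrite /tensor_pi [RHS](_ : _ = Quotient.add (\pi u) (Quotient.opp (\pi v))) //
  -Quotient.pi_opp -Quotient.pi_add.
Qed.
HB.instance Definition _ := GRing.isZmodMorphism.Build F tensor tensor_pi tensor_piB.

Fact tensor_pi_surj (t : tensor) : exists u, tensor_pi u = t.
Proof. by exists (repr (t : Quotient.quot tensor_null)); exact: reprK. Qed.

Fact tensor_piP u v : tensor_pi u = tensor_pi v <-> tensor_gen (u - v).
Proof.
by rewrite /tensor_pi; split=> [/eqP|?]; last apply/eqP;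
  rewrite -Quotient.idealrBE => *; apply/asboolP.
Qed.

Fact pureDl x x' y : pure (x + x') y = pure x y + pure x' y.
Proof. by rewrite -raddfD; apply/tensor_piP/TensorRel/TensorDl. Qed.
Fact pureDr x y y' : pure x (y + y') = pure x y + pure x y'.
Proof. by rewrite -raddfD; apply/tensor_piP/TensorRel/TensorDr. Qed.
Fact pureZ (b : B) x y : pure ((b : B^c) *: x) y = pure x (b *: y).
Proof. by apply/tensor_piP/TensorRel/TensorZ. Qed.

Fact tensor_ext (G : zmodType) (f g : {additive tensor -> G}) :
  (forall x y, f (pure x y) = g (pure x y)) -> f =1 g.
Proof.
move=> fg t; have [u <-] := tensor_pi_surj t.
elim/freeg_ind_dom0: u => [|k [x y] D _ _ IH]; first by rewrite !raddf0.
rewrite !raddfD IH; congr (_ + _).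
have -> : << k *g (x, y) >> = << (x, y) >> *~ k :> F.
  by rewrite freeg_mulz intz.
by rewrite !raddfMz /= fg.
Qed.

Section Lift.
Variables (G : zmodType) (beta : X -> Y -> G).
Hypothesis betaDl : forall x x' y, beta (x + x') y = beta x y + beta x' y.
Hypothesis betaDr : forall x y y', beta x (y + y') = beta x y + beta x y'.
Hypothesis betaZ : forall (b : B) x y, beta ((b : B^c) *: x) y = beta x (b *: y).

Let lift0 (u : F) : G := fglift (fun p => beta p.1 p.2 : zmodule G) u.
Let lift0B : {morph lift0 : u v / u - v}.
Proof. exact: (@lift_is_additive _ _ (zmodule G) (fun p => beta p.1 p.2)). Qed.
Let lift0U x y : lift0 <<(x, y)>> = beta x y.
Proof. by rewrite /lift0 (@liftU _ (zmodule G)) scale1r. Qed.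
Let lift0D : {morph lift0 : u v / u + v}.
Proof.
have l0 : lift0 0 = 0 by rewrite -[X in lift0 X](subrr 0) lift0B subrr.
by move=> u v; rewrite -[v in LHS]opprK lift0B -[- v]sub0r lift0B l0 sub0r opprK.
Qed.

Definition tensor_lift (t : tensor) : G := lift0 (repr (t : Quotient.quot tensor_null)).

Let tensor_lift_pi u : tensor_lift (tensor_pi u) = lift0 u.
Proof.
have : tensor_pi (repr (tensor_pi u : Quotient.quot tensor_null)) = tensor_pi u.
  exact: reprK.
move/tensor_piP; rewrite /tensor_lift; set v := repr _ => h.
apply/eqP; rewrite -subr_eq0 -lift0B; apply/eqP.
elim: h => [_ [x x' y|x y y'|b x y]||w w' _ hw _ hw'].
- by rewrite lift0B lift0D !lift0U betaDl subrr.
- by rewrite lift0B lift0D !lift0U betaDr subrr.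
- by rewrite lift0B !lift0U betaZ subrr.
- by rewrite -[X in lift0 X](subrr 0) lift0B subrr.
- by rewrite lift0B hw hw' subrr.
Qed.

Fact tensor_lift_pure x y : tensor_lift (pure x y) = beta x y.
Proof. by rewrite tensor_lift_pi lift0U. Qed.

Fact tensor_liftB : {morph tensor_lift : s t / s - t}.
Proof.
move=> s t; have [u <-] := tensor_pi_surj s; have [v <-] := tensor_pi_surj t.
by rewrite -raddfB !tensor_lift_pi lift0B.
Qed.

End Lift.
End Tensor.

Section TensorMap.
Variables (B : pzRingType) (X X' : rmodType B) (Y Y' : lmodType B).
Variables (f : {linear X -> X'}) (g : {linear Y -> Y'}).

Let beta (x : X) (y : Y) : tensor X' Y' := pure (f x) (g y).
Let betaDl x x' y : beta (x + x') y = beta x y + beta x' y.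
Proof. by rewrite /beta linearD pureDl. Qed.
Let betaDr x y y' : beta x (y + y') = beta x y + beta x y'.
Proof. by rewrite /beta linearD pureDr. Qed.
Let betaZ (b : B) x y : beta ((b : B^c) *: x) y = beta x (b *: y).
Proof. by rewrite /beta !linearZ /= pureZ. Qed.

Definition tensor_map : tensor X Y -> tensor X' Y' :=
  tensor_lift (fun x y => pure (f x) (g y)).

Fact tensor_map_pure x y : tensor_map (pure x y) = pure (f x) (g y).
Proof. exact: tensor_lift_pure. Qed.

Fact tensor_mapB : {morph tensor_map : s t / s - t}.
Proof. exact: tensor_liftB. Qed.
HB.instance Definition _ :=
  GRing.isZmodMorphism.Build (tensor X Y) (tensor X' Y') tensor_map tensor_mapB.

End TensorMap.

(* P (x)_B Y as a left A-module, for P an (A, B)-bimodule. *)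
Section LeftTensor.
Variables (A B : pzRingType) (P : bimodule A B) (Y : lmodType B).

Definition ltensor : Type := tensor P Y.
HB.instance Definition _ := GRing.Zmodule.on ltensor.

Definition ltensor_scale (a : A) (t : ltensor) : ltensor :=
  tensor_map (lact a : {linear P -> P}) (idfun : {linear Y -> Y}) t.

Fact ltensor_scaleA a b t : ltensor_scale a (ltensor_scale b t) = ltensor_scale (a * b) t.
Proof.
apply: (tensor_ext (f := tensor_map (lact a : {linear P -> P}) idfun \o
                         tensor_map (lact b : {linear P -> P}) idfun)
                   (g := tensor_map (lact (a * b) : {linear P -> P}) idfun)) => x y /=.
by rewrite !tensor_map_pure /= lactA.
Qed.
Fact ltensor_scale1 : left_id 1 ltensor_scale.
Proof.
apply: (tensor_ext (f := tensor_map (lact 1 : {linear P -> P}) idfun) (g := idfun)) => x y /=.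
by rewrite tensor_map_pure /= lact1.
Qed.
Fact ltensor_scaleDr : right_distributive ltensor_scale +%R.
Proof. by move=> a s t; rewrite /ltensor_scale raddfD. Qed.
Fact ltensor_scaleDl t : {morph ltensor_scale^~ t : a b / a + b}.
Proof.
move=> a b; apply: (tensor_ext (f := tensor_map (lact (a + b) : {linear P -> P}) idfun)
  (g := tensor_map (lact a : {linear P -> P}) idfun \+
        tensor_map (lact b : {linear P -> P}) idfun)) => x y /=.
by rewrite !tensor_map_pure /= lactDl pureDl.
Qed.

HB.instance Definition _ := GRing.Zmodule_isLmodule.Build A ltensor
  ltensor_scaleA ltensor_scale1 ltensor_scaleDr ltensor_scaleDl.

End LeftTensor.

(* X (x)_B N as a right C-module, for N a (B, C)-bimodule. *)
Section RightTensor.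
Variables (B C : pzRingType) (X : rmodType B) (N : bimodule B C).

Definition rtensor : Type := tensor X (bimod_l N).
HB.instance Definition _ := GRing.Zmodule.on rtensor.

Local Notation rmap c := (tensor_map (idfun : {linear X -> X})
  (right_mul c : {linear bimod_l N -> bimod_l N})).

Definition rtensor_scale (c : C^c) (t : rtensor) : rtensor := rmap c t.

Fact rtensor_scaleA c d t : rtensor_scale c (rtensor_scale d t) = rtensor_scale (c * d) t.
Proof.
apply: (tensor_ext (f := rmap c \o rmap d) (g := rmap (c * d))) => x y /=.
by rewrite !tensor_map_pure /= /right_mul scalerA.
Qed.
Fact rtensor_scale1 : left_id 1 rtensor_scale.
Proof.
apply: (tensor_ext (f := rmap 1) (g := idfun)) => x y /=.
by rewrite tensor_map_pure /= /right_mul scale1r.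
Qed.
Fact rtensor_scaleDr : right_distributive rtensor_scale +%R.
Proof. by move=> c s t; rewrite /rtensor_scale raddfD. Qed.
Fact rtensor_scaleDl t : {morph rtensor_scale^~ t : c d / c + d}.
Proof.
move=> c d; apply: (tensor_ext (f := rmap (c + d)) (g := rmap c \+ rmap d)) => x y /=.
by rewrite !tensor_map_pure /= /right_mul scalerDl pureDr.
Qed.

HB.instance Definition _ := GRing.Zmodule_isLmodule.Build C^c rtensor
  rtensor_scaleA rtensor_scale1 rtensor_scaleDr rtensor_scaleDl.

End RightTensor.

Record functor (A B : pzRingType) := Functor {
  fobj :> lmodType A -> lmodType B;
  fmap : forall M N : lmodType A, {linear M -> N} -> {linear fobj M -> fobj N};
  fmap_id : forall M : lmodType A, fmap (idfun : {linear M -> M}) = idfun;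
  fmap_comp : forall (M N L : lmodType A) (g : {linear N -> L}) (f : {linear M -> N}),
    fmap (g \o f) = fmap g \o fmap f
}.

Definition functor_equivalence (A B : pzRingType) (F : functor A B) : Prop :=
  exists (G : functor B A)
         (eta : forall M : lmodType A, {linear M -> G (F M)})
         (eps : forall N : lmodType B, {linear F (G N) -> N}),
    [/\ forall M, bijective (eta M),
        forall N, bijective (eps N),
        forall (M M' : lmodType A) (f : {linear M -> M'}) x, eta M' (f x) = fmap G (fmap F f) (eta M x)
      & forall (N N' : lmodType B) (g : {linear N -> N'}) y, eps N' (fmap F (fmap G g) y) = g (eps N y)].

Section TensorFunctor.
Variables (A B : pzRingType) (P : bimodule A B).

Definition ltensor_map (M N : lmodType B) (f : {linear M -> N}) : ltensor P M -> ltensor P N :=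
  tensor_map (idfun : {linear P -> P}) f.

Fact ltensor_map_linear M N f : linear (@ltensor_map M N f).
Proof.
move=> a s t; rewrite /ltensor_map raddfD; congr (_ + _).
apply: (tensor_ext (f := tensor_map idfun f \o tensor_map (lact a : {linear P -> P}) idfun)
                   (g := tensor_map (lact a : {linear P -> P}) idfun \o tensor_map idfun f)).
by move=> x y /=; rewrite !tensor_map_pure.
Qed.

HB.instance Definition _ (M N : lmodType B) (f : {linear M -> N}) :=
  GRing.isLinear.Build A (ltensor P M) (ltensor P N) _ (ltensor_map f) (ltensor_map_linear f).

Fact ltensor_map_id (M : lmodType B) :
  (ltensor_map (idfun : {linear M -> M}) : {linear ltensor P M -> ltensor P M}) = idfun.
Proof.
apply: linear_ext.
apply: (tensor_ext (f := tensor_map idfun idfun) (g := idfun)) => x y /=.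
by rewrite tensor_map_pure.
Qed.

Fact ltensor_map_comp (M N L : lmodType B) (g : {linear N -> L}) (f : {linear M -> N}) :
  (ltensor_map (g \o f) : {linear ltensor P M -> ltensor P L}) =
  ltensor_map g \o ltensor_map f.
Proof.
apply: linear_ext.
apply: (tensor_ext (f := tensor_map idfun (g \o f))
                   (g := tensor_map idfun g \o tensor_map idfun f)) => x y /=.
by rewrite !tensor_map_pure.
Qed.

Definition tensor_functor : functor B A :=
  @Functor B A (fun M => ltensor P M) (fun M N f => ltensor_map f)
    ltensor_map_id ltensor_map_comp.

Definition invertible : Prop := functor_equivalence tensor_functor.

End TensorFunctor.

Section Tilting.
Variable R : pzRingType.
Implicit Types (T M N : rmodType R) (C : rmodType R -> Prop).

Definition perp T M : Prop := forall i, (0 < i)%N -> Ext_zero i T M.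

Definition left_perp C M : Prop :=
  forall X, C X -> forall i, (0 < i)%N -> Ext_zero i M X.

Definition Gen_star T M : Prop :=
  exists P : resolution M,
    (forall i, Add T (P i)) /\ (forall i, Ext_zero 1 T (res_ker P i)).

Definition gen_star T M : Prop :=
  exists P : resolution M,
    (forall i, add T (P i)) /\ (forall i, Ext_zero 1 T (res_ker P i)).

Definition cogen_star T M : Prop :=
  exists D : coresolution M,
    (forall i, add T (D i)) /\ (forall i, Ext_zero 1 (cores_coker D i) T).

Definition right_regular : rmodType R := (R^c)^o.

Definition wakamatsu_tilting T : Prop :=
  [/\ forall i, (0 < i)%N -> Ext_zero i T T,
      gen_star right_regular T
    & cogen_star T right_regular].

Definition sim T T' : Prop :=
  exists (P : bimodule (endo T) (endo T')) (Q : bimodule (endo T') (endo T)),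
    [/\ invertible P, invertible Q,
        isomorphic T (rtensor P (endo_bimod T'))
      & isomorphic T' (rtensor Q (endo_bimod T))].

Definition Xbar T M : Prop := perp T M /\ Gen_star T M.

(* A full subcategory closed under isomorphism is given by its objects. *)
Definition subcategory C : Prop := forall M N, isomorphic M N -> C M -> C N.

Definition coresolving_bar C : Prop :=
  [/\ forall M N, summand M N -> C N -> C M,
      forall (L M N : rmodType R) (f : {linear L -> M}) (g : {linear M -> N}),
        short_exact f g -> C L -> C N -> C M,
      forall (L M N : rmodType R) (f : {linear L -> M}) (g : {linear M -> N}),
        short_exact f g -> C L -> C M -> C N
    & forall E, injective_module E -> C E].

Definition preenveloping C : Prop :=
  forall M, exists (CM : rmodType R) (phi : {linear M -> CM}),
    C CM /\ forall (N : rmodType R) (h : {linear M -> N}), C N ->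
      exists k : {linear CM -> N}, forall x, k (phi x) = h x.

Definition preenveloping_coresolving C : Prop :=
  [/\ subcategory C, preenveloping C & coresolving_bar C].

Definition ext_proj_generator C T : Prop :=
  [/\ C T, left_perp C T
    & forall M, C M ->
        exists (M' T' : rmodType R) (f : {linear M' -> T'}) (g : {linear T' -> M}),
          [/\ short_exact f g, Add T T' & C M']].

Definition maximal_subcat C : Prop :=
  preenveloping_coresolving C /\
  exists T, [/\ ext_proj_generator C T, gen_star right_regular T
    & forall C', preenveloping_coresolving C' -> ext_proj_generator C' T ->
        (forall M, C M -> C' M) -> forall M, C' M -> C M].

Definition sim_class T : rmodType R -> Prop :=
  fun T' => wakamatsu_tilting T' /\ sim T T'.

Definition tilting_classes : Type :=
  {E : rmodType R -> Prop | exists T, wakamatsu_tilting T /\ E = sim_class T}.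

Definition class_of T (hT : wakamatsu_tilting T) : tilting_classes :=
  exist _ (sim_class T) (ex_intro _ T (conj hT erefl)).

Definition maximal_subcats : Type := {C : rmodType R -> Prop | maximal_subcat C}.

End Tilting.

(* Main.v *)
(* Fix a Wakamatsu tilting module T, a resolution Q of T by finitely generated
   projectives with syzygies W_n, and a coresolution 0 -> R -> D_0 -> D_1 -> ...
   in add(T) with cosyzygies A_n (A_0 = R).  The heart of the proof is that the
   intersection of T^perp and Gen*(T) is an injectivity class: N belongs to it
   iff Ext^1(W_n, N) = 0 and every map A_n -> N extends to D_n, for all n.  The
   closure properties are then immediate, and since the W_n and A_n are finitely
   generated a small object argument with countably many steps provides
   preenvelopes.  Conversely, if T is an Ext-projective generator of C, then the
   C-preenvelope of a finitely generated Ext-projective module factors through a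
   finite power of T; iterating this from R yields the coresolution of R.  Two
   Wakamatsu tilting modules have the same class iff each lies in add of the
   other, and by Morita theory this is the relation sim. *)
From HB Require Import structures.
From mathcomp Require Import all_boot all_algebra.
From mathcomp Require Import boolp classical_sets functions cardinality finmap.
From mathcomp.multinomials Require Import freeg.
Require Import Defs.

Set Implicit Arguments.
Unset Strict Implicit.
Unset Printing Implicit Defensive.

Import GRing.Theory Num.Theory.
Local Open Scope ring_scope.

(** * Linear maps and exact sequences *)

Section Toolkit.
Variable A : pzRingType.
Implicit Types U V W X Y K L M N C T : lmodType A.

(** Two lifting conditions carry all the homological algebra: [ext1_zero C N] (maps from C lift
    through epimorphisms with kernel N) and [extends a N] (maps to N extend along [a]). Higher Ext
    is [ext1_zero] of a syzygy, so the needed parts of long exact sequences become chases without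
    connecting maps. Such conditions pass to retracts, which is why modules are compared up to
    retract rather than isomorphism. Membership in Gen* is an infinite condition; it is handled
    coinductively, as the greatest class closed under taking one good cover. This makes maximality
    cheap: any class with Ext-projective generator T has its own covers as witnesses, so it lies in
    [Xbar T], which is thus the greatest such class. Finite generation serves a second purpose
    besides the small object argument: orthogonality is assumed for T alone, and it is the finite
    support of maps into $T^{(I)}$ that carries it over to $\mathrm{Add}(T)$. *)

Lemma linear_of U V (f : U -> V) :
  linear f -> exists g : {linear U -> V}, forall x, g x = f x.
Proof.
move=> f_lin.
pose F : {linear U -> V} := HB.pack f (GRing.isLinear.Build A U V _ f f_lin).
by exists F.
Qed.

Lemma linear_pair U V W (f : {linear U -> V}) (g : {linear U -> W}) :
  exists h : {linear U -> (V * W)%type}, forall x, h x = (f x, g x).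
Proof.
by apply: linear_of => a x y; rewrite !linearP.
Qed.

Lemma linear_copair U V W (f : {linear U -> W}) (g : {linear V -> W}) :
  exists h : {linear (U * V)%type -> W}, forall x, h x = f x.1 + g x.2.
Proof.
apply: linear_of => a x y /=.
by rewrite !linearP scalerDr addrACA.
Qed.

Lemma descend U V W (q : {linear U -> V}) (k : {linear U -> W}) :
  surj q -> (forall x, q x = 0 -> k x = 0) ->
  exists k' : {linear V -> W}, forall x, k' (q x) = k x.
Proof.
move=> q_surj qk; have [s sP] := choice q_surj.
have kE x y : q x = q y -> k x = k y.
  by move=> /eqP; rewrite -subr_eq0 -linearB => /eqP /qk /eqP;
    rewrite linearB subr_eq0 => /eqP.
have [|k' k'E] := @linear_of V W (k \o s).
  by move=> a x y /=; rewrite -linearP; apply: kE; rewrite linearP !sP.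
by exists k' => x; rewrite k'E; apply: kE; rewrite sP.
Qed.

Lemma corestrict U V W (i : {linear U -> V}) (k : {linear W -> V}) :
  injective i -> (forall x, exists y, i y = k x) ->
  exists k' : {linear W -> U}, forall x, i (k' x) = k x.
Proof.
move=> i_inj /choice[s sP].
have [|k' k'E] := @linear_of W U s.
  by move=> a x y; apply: i_inj; rewrite linearP !sP linearP.
by exists k' => x; rewrite k'E.
Qed.

Lemma inj0 U V (i : {linear U -> V}) :
  (forall x, i x = 0 -> x = 0) -> injective i.
Proof.
move=> i0 x y ixy; apply/eqP; rewrite -subr_eq0; apply/eqP/i0.
by rewrite linearB ixy subrr.
Qed.

Lemma linear_inverse U V (f : {linear U -> V}) : bijective f ->
  exists g : {linear V -> U}, cancel f g /\ cancel g f.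
Proof.
case=> g fK gK; have [|g' g'E] := @linear_of V U g.
  by move=> a x y; apply: (can_inj fK); rewrite linearP !gK.
by exists g'; split=> x; rewrite g'E.
Qed.

Lemma short_exact_ker U V (g : {linear U -> V}) : surj g ->
  short_exact (val : kernel g -> U) g.
Proof.
move=> g_surj; split=> //.
move=> y; split=> [y0|[x <-]]; last exact/eqP/(valP x).
have yk : y \in ker_pred g by apply/eqP.
by exists (Kernel yk).
Qed.

Lemma short_exact_coker U V (f : {linear U -> V}) : injective f ->
  short_exact f (@coker_proj _ _ _ f).
Proof.
move=> f_inj; split=> //; last exact: coker_proj_surj.
move=> y; rewrite -[X in _ = X](linear0 (@coker_proj _ _ _ f)) coker_projP.
by rewrite subr0.
Qed.

Lemma short_exact_comp0 U V W (f : {linear U -> V}) (g : {linear V -> W}) :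
  short_exact f g -> forall x, g (f x) = 0.
Proof. by case=> _ fg _ x; apply/fg; exists x. Qed.

(* The submodule is the kernel of the projection onto the quotient of U by the
   image of the free module on its elements. *)
Lemma submodule_exists U (P : U -> Prop) :
  P 0 -> (forall x y, P x -> P y -> P (x + y)) ->
  (forall a x, P x -> P (a *: x)) ->
  exists (V : lmodType A) (i : {linear V -> U}),
    injective i /\ forall x, P x <-> exists v, i v = x.
Proof.
move=> P0 PD PZ.
pose f : {linear dsum {classic {x | P x}} A^o -> U} :=
  @dsum_lift A {classic {x | P x}} U (fun p => sval p).
have fP y : P (f y).
  by rewrite /f /= /dsum_lift; apply: big_ind => // p _; apply/PZ/(svalP p).
exists (kernel (@coker_proj _ _ _ f)), (val : kernel (@coker_proj _ _ _ f) -> U).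
split; first by move=> x y /val_inj.
move=> x; have [_ ex _] := short_exact_ker (@coker_proj_surj _ _ _ f).
rewrite -ex -[X in _ = X](linear0 (@coker_proj _ _ _ f)) coker_projP subr0.
split=> [Px|[y <-]]; last exact: fP.
exists (dirac A (exist _ x Px : {classic {x | P x}})).
exact: dsum_lift_dirac.
Qed.

(** The pushout is the cokernel of $x\mapsto(h x,-a x)$ into $N\times V$. The clauses are chosen so
    that later chases need not touch the quotient. *)
Lemma pushout_exists U V N (a : {linear U -> V}) (h : {linear U -> N}) :
  injective a ->
  exists (X : lmodType A) (f : {linear N -> X}) (b : {linear V -> X}),
    [/\ injective f, forall x, b (a x) = f (h x),
       forall z, exists n v, z = f n + b v,
       forall n v, f n + b v = 0 -> exists x, n = h x /\ v = - a x
     & forall Y (u : {linear N -> Y}) (w : {linear V -> Y}),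
         (forall x, w (a x) = u (h x)) ->
         exists k : {linear X -> Y},
           (forall n, k (f n) = u n) /\ (forall v, k (b v) = w v)].
Proof.
move=> a_inj.
have [d dE] : exists d : {linear U -> (N * V)%type}, forall x, d x = (h x, - a x).
  by apply: linear_of => c x y; rewrite !linearP.
pose pi := @coker_proj _ _ _ d.
have [f fE] : exists f : {linear N -> cokernel d}, forall n, f n = pi (n, 0).
  apply: linear_of => c x y; rewrite -linearP; congr (pi _).
  by congr pair; rewrite /= ?scaler0 ?addr0.
have [b bE] : exists b : {linear V -> cokernel d}, forall v, b v = pi (0, v).
  apply: linear_of => c x y; rewrite -linearP; congr (pi _).
  by congr pair; rewrite /= ?scaler0 ?addr0.
have fbE n v : f n + b v = pi (n, v).
  by rewrite fE bE -linearD; congr (pi _); congr pair; rewrite /= ?addr0 ?add0r.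
have pi0 n v : pi (n, v) = 0 -> exists x, n = h x /\ v = - a x.
  rewrite -[X in _ = X](linear0 pi) => /coker_projP[x]; rewrite dE subr0 => -[<- <-].
  by exists x.
exists (cokernel d), f, b; split.
- apply: inj0 => n; rewrite fE => /pi0[x [-> /esym/eqP]].
  rewrite oppr_eq0 => /eqP ax0.
  by rewrite (_ : x = 0) ?linear0 //; apply: a_inj; rewrite linear0.
- move=> x; rewrite fE bE; apply/coker_projP; exists (- x).
  by rewrite dE !linearN opprK; congr pair; rewrite /= ?sub0r ?subr0.
- by move=> z; have [[n v] <-] := coker_proj_surj z; exists n, v; rewrite fbE.
- by move=> n v; rewrite fbE; exact: pi0.
- move=> Y u w uw.
  have [k kE] := linear_copair u w.
  have [|p|k' k'E] := @descend _ _ _ pi k; first exact: coker_proj_surj.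
    by case: p => n v /pi0[x [-> ->]]; rewrite kE /= linearN uw subrr.
  exists k'; split=> [n|v]; rewrite ?fE ?bE k'E kE /=; rewrite linear0 ?addr0 ?add0r //.
Qed.

(** Vanishing of $\mathrm{Ext}^1(C,N)$ without resolutions: pulling an extension back along [h]
    shows that lifting all maps amounts to splitting all extensions of C by N. [Ext_zero1P]
    identifies this with [Ext_zero 1]. *)
Definition ext1_zero C N : Prop :=
  forall X Y (f : {linear N -> X}) (g : {linear X -> Y}), short_exact f g ->
  forall h : {linear C -> Y}, exists k : {linear C -> X}, forall x, g (k x) = h x.

Definition extends U V (a : {linear U -> V}) N : Prop :=
  forall h : {linear U -> N}, exists k : {linear V -> N}, forall x, k (a x) = h x.

(** The pushout of the sequence along [h] is an extension of C by N. It splits, and its retraction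
    onto N, restricted to V, extends [h]. *)
Lemma ext1_extends U V C N (a : {linear U -> V}) (q : {linear V -> C}) :
  short_exact a q -> ext1_zero C N -> extends a N.
Proof.
move=> aq eC h; case: (aq) => a_inj aqE q_surj.
have [X [f [b [f_inj baE XE X0 XU]]]] := pushout_exists h a_inj.
have [|g [gf gb]] := XU C \0 q; first by move=> x; rewrite (short_exact_comp0 aq).
have fg : short_exact f g.
  split=> // [z|c]; last by have [v <-] := q_surj c; exists (b v).
  split=> [|[n <-]]; last by rewrite gf.
  have [n [v ->]] := XE z; rewrite linearD gf gb add0r => /aqE[x <-].
  by exists (n + h x); rewrite baE linearD.
have [k kP] := eC _ _ _ _ fg idfun.
have [|r rP] := @corestrict _ _ _ f (idfun \- (k \o g)) f_inj.
  by move=> z; case: fg => _ fgE _; apply/fgE; rewrite linearB /= kP subrr.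
exists (r \o b) => x /=; apply: f_inj.
by rewrite rP /= baE gf linear0 subr0.
Qed.

(** A lift of $h q$ to X maps U into N; subtracting an extension of that restriction to V makes it
    vanish on U, so it descends to C. Together with [ext1_extends] this is the segment
    $\mathrm{Hom}(V,N)\to\mathrm{Hom}(U,N)\to\mathrm{Ext}^1(C,N)\to\mathrm{Ext}^1(V,N)$. *)
Lemma extends_ext1 U V C N (a : {linear U -> V}) (q : {linear V -> C}) :
  short_exact a q -> ext1_zero V N -> extends a N -> ext1_zero C N.
Proof.
move=> aq eV aN X Y f g fg h; case: (aq) => a_inj aqE q_surj.
case: (fg) => f_inj fgE g_surj.
have [k kP] := eV _ _ _ _ fg (h \o q).
have [|k1 k1P] := @corestrict _ _ _ f (k \o a) f_inj.
  by move=> x; apply/fgE; rewrite kP /= (short_exact_comp0 aq) linear0.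
have [k2 k2P] := aN k1.
have [||l lP] := @descend _ _ _ q (k \- (f \o k2)) => //.
  by move=> x /aqE[y <-] /=; rewrite k2P k1P subrr.
exists l => c; have [x <-] := q_surj c.
by rewrite lP linearB /= kP (short_exact_comp0 fg) subr0.
Qed.

Lemma projective_ext1 M N : projective M -> ext1_zero M N.
Proof. by move=> pM X Y f g [_ _ g_surj] h; exact: pM. Qed.

Lemma injective_ext1 M N : injective_module N -> ext1_zero M N.
Proof.
move=> jN X Y f g fg h; case: (fg) => f_inj fgE g_surj.
have [r rP] := jN _ _ f idfun f_inj.
have [||s sP] := @descend _ _ _ g (idfun \- (f \o r)) => //.
  by move=> x /fgE[n <-] /=; rewrite rP subrr.
exists (s \o h) => x /=; have [y <-] := g_surj (h x).
by rewrite sP linearB /= (short_exact_comp0 fg) subr0.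
Qed.

(** Over a free cover of C the condition becomes extension of maps from its kernel. A map [h] to M
    is treated in two steps: $g h$ extends and lifts back through [g] by projectivity, and the
    remaining difference takes values in L. *)
Lemma ext1_extension C L M N (f : {linear L -> M}) (g : {linear M -> N}) :
  short_exact f g -> ext1_zero C L -> ext1_zero C N -> ext1_zero C M.
Proof.
move=> fg eL eN; case: (fg) => f_inj fgE g_surj.
have kerP := short_exact_ker (@cover_surj A C).
have pP : projective (cover C) by exact: dsum_projective.
apply: (extends_ext1 kerP (projective_ext1 pP)) => h.
have [k1 k1P] := ext1_extends kerP eN (g \o h).
have [k2 k2P] := pP _ _ g k1 g_surj.
have [|h' h'P] := @corestrict _ _ _ f (h \- (k2 \o (val : kernel (@cover_map A C) -> _))) f_inj.
  by move=> x; apply/fgE; rewrite linearB /= k2P k1P /= subrr.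
have [k3 k3P] := ext1_extends kerP eL h'.
exists (k2 \+ (f \o k3)) => x /=.
by rewrite k3P h'P /= addrC subrK.
Qed.

(** * Direct sums, direct summands and finitely generated modules *)

Section DSum.
Variables (I : choiceType) (M : lmodType A).

Lemma dsum_in_finsupp (i : I) (m : M) :
  (fun j => if j == i then m else 0) \in @finsupp A I M.
Proof.
apply/asboolP; apply: sub_finite_set (finite_set1 i) => j /=.
by case: eqP => // _ /(_ erefl).
Qed.

Definition dsum_in (i : I) (m : M) : dsum I M := DSum (dsum_in_finsupp i m).

Lemma dsum_inE i m j : dsum_in i m j = if j == i then m else 0.
Proof. by []. Qed.

Lemma dsum_eqP (x y : dsum I M) : (forall i, x i = y i) -> x = y.
Proof. by move=> xy; apply/val_inj/funext. Qed.

Lemma dsum_in_linear i : linear (dsum_in i).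
Proof.
move=> a x y; apply: dsum_eqP => j.
rewrite [RHS](_ : _ = a *: dsum_in i x j + dsum_in i y j) // !dsum_inE.
by case: ifP => // _; rewrite scaler0 addr0.
Qed.

HB.instance Definition _ i :=
  GRing.isLinear.Build A M (dsum I M) _ (dsum_in i) (dsum_in_linear i).

Definition dsum_supp (x : dsum I M) : {fset I} := fset_set [set i | x i <> 0]%classic.

Lemma dsum_suppP (x : dsum I M) i : (i \in dsum_supp x) = (x i != 0).
Proof.
have fx : finite_set [set i | x i <> 0]%classic by apply/asboolP; exact: (valP x).
rewrite in_fset_set //; apply/idP/idP => [/set_mem /= /eqP //|/eqP xi].
exact: mem_set.
Qed.

Lemma dsum_sum_evalE (J : Type) (s : seq J) (F : J -> dsum I M) i :
  (\sum_(j <- s) F j) i = \sum_(j <- s) F j i.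
Proof. by elim/big_rec2: _ => // j x y _ <-. Qed.

Lemma dsumE (x : dsum I M) (s : {fset I}) :
  (forall i, x i != 0 -> i \in s) -> x = \sum_(i <- s) dsum_in i (x i).
Proof.
move=> xs; apply: dsum_eqP => i; rewrite dsum_sum_evalE.
have [xi0|xi0] := eqVneq (x i) 0.
  rewrite xi0 big1_seq // => j _; rewrite dsum_inE.
  by case: eqP => // <-.
rewrite (big_fsetD1 i) ?xs // dsum_inE eqxx big1_seq => [|j /andP[_]].
  exact/esym/addr0.
by rewrite !inE eq_sym dsum_inE => /andP[/negPf->].
Qed.

Lemma dsum_ind (D : dsum I M -> Prop) :
  D 0 -> (forall x y, D x -> D y -> D (x + y)) ->
  (forall i m, D (dsum_in i m)) -> forall x, D x.
Proof.
move=> D0 DD Di x; rewrite (@dsumE x (dsum_supp x)).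
  by apply: big_ind => // i _; exact: Di.
by move=> i; rewrite dsum_suppP.
Qed.

Lemma dsum_ext N (f g : {linear dsum I M -> N}) :
  (forall i m, f (dsum_in i m) = g (dsum_in i m)) -> forall x, f x = g x.
Proof.
move=> fg; apply: dsum_ind => [|x y fx fy|//]; rewrite ?linear0 //.
by rewrite !linearD fx fy.
Qed.

Lemma dsum_ev i : exists e : {linear dsum I M -> M}, forall x, e x = x i.
Proof. exact: linear_of. Qed.

Lemma dsum_lift_exists N (phi : I -> {linear M -> N}) :
  exists F : {linear dsum I M -> N}, forall i m, F (dsum_in i m) = phi i m.
Proof.
pose F (x : dsum I M) := \sum_(i <- dsum_supp x) phi i (x i).
have FE (x : dsum I M) (s : {fset I}) : (forall i, x i != 0 -> i \in s) ->
    F x = \sum_(i <- s) phi i (x i).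
  move=> xs; rewrite /F [RHS](bigID (fun i => x i != 0)) /=.
  rewrite [X in _ = _ + X]big1 ?addr0; last first.
    by move=> i; rewrite negbK => /eqP->; rewrite linear0.
  rewrite -[RHS]big_filter; apply: perm_big; apply: uniq_perm.
  - exact: fset_uniq.
  - exact/filter_uniq/fset_uniq.
  - move=> i; rewrite mem_filter dsum_suppP.
    by case: (boolP (x i != 0)) => //= /xs.
have [|F' F'E] := @linear_of (dsum I M) N F.
  move=> a x y; pose s := (dsum_supp x `|` dsum_supp y)%fset.
  have xs i : x i != 0 -> i \in s by rewrite inE dsum_suppP => ->.
  have ys i : y i != 0 -> i \in s by rewrite inE orbC dsum_suppP => ->.
  rewrite (FE _ _ xs) (FE _ _ ys) (FE _ s) => [|i].
    rewrite scaler_sumr -big_split; apply: eq_bigr => i _ /=.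
    by rewrite -linearP.
  apply: contraNT => si; apply/eqP.
  have -> : (a *: x + y) i = a *: x i + y i by [].
  have /eqP-> : x i == 0 by apply: contraNT si => /xs.
  have /eqP-> : y i == 0 by apply: contraNT si => /ys.
  by rewrite scaler0 addr0.
exists F' => i m; rewrite F'E (FE _ [fset i]%fset) => [|j].
  by rewrite big_seq_fset1 dsum_inE eqxx.
by rewrite dsum_inE inE; case: (j == i); rewrite ?eqxx.
Qed.

End DSum.

Lemma dsum_map_exists (I : choiceType) M N (f : {linear M -> N}) :
  exists F : {linear dsum I M -> dsum I N}, forall x i, F x i = f (x i).
Proof.
have [F FE] := dsum_lift_exists (fun i : I => dsum_in i \o f).
exists F => x i; have [e eE] := dsum_ev N i; have [e' e'E] := dsum_ev M i.
rewrite -eE -e'E; apply: (dsum_ext (f := e \o F) (g := f \o e')) => j m.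
by rewrite /= FE eE e'E /=; case: ifP => //; rewrite linear0.
Qed.

(** The working form of [summand]: no complement has to be named, and sections and retractions
    compose. *)
Definition retract M N : Prop :=
  exists (s : {linear M -> N}) (p : {linear N -> M}), cancel s p.

Lemma retract_refl M : retract M M.
Proof. by exists idfun, idfun. Qed.

Lemma retract_trans M N L : retract M N -> retract N L -> retract M L.
Proof.
by move=> [s [p sp]] [s' [p' sp']]; exists (s' \o s), (p \o p'); exact: can_comp.
Qed.

Lemma isomorphic_retract M N : isomorphic M N -> retract M N.
Proof. by move=> [f /linear_inverse[g [fK _]]]; exists f, g. Qed.

Lemma isomorphic_sym M N : isomorphic M N -> isomorphic N M.
Proof. by move=> [f /linear_inverse[g [fK gK]]]; exists g, f. Qed.

Lemma summandP M N : summand M N <-> retract M N.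
Proof.
split=> [[M' /isomorphic_retract MM'N]|[s [p sp]]].
  apply: retract_trans MM'N.
  have [s sE] := linear_pair (idfun : {linear M -> M}) (\0 : {linear M -> M'}).
  by exists s, fst => x; rewrite sE.
exists (kernel p).
have [f fE] := linear_copair s (val : kernel p -> N).
have p_surj : surj p by move=> y; exists (s y).
have kerp := short_exact_ker p_surj.
have [||r rP] := @corestrict _ _ _ (val : kernel p -> N) (idfun \- (s \o p)).
- by move=> x y /val_inj.
- by move=> x; case: kerp => _ ex _; apply/ex; rewrite linearB /= sp subrr.
exists f, (fun y => (p y, r y)) => [[x k]|y].
  rewrite fE linearD /= sp (short_exact_comp0 kerp) addr0; congr pair.
  apply: val_inj; rewrite [LHS]rP /= linearD sp (short_exact_comp0 kerp) addr0.
  by rewrite addrC addKr.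
by rewrite fE /= [\val (r y)]rP /= addrC subrK.
Qed.

Lemma dsum_retract (I : choiceType) M N : retract M N -> retract (dsum I M) (dsum I N).
Proof.
move=> [s [p sp]].
have [S SE] := dsum_map_exists I s; have [P PE] := dsum_map_exists I p.
by exists S, P => x; apply: dsum_eqP => i; rewrite PE SE sp.
Qed.

Lemma dsum_dsum_retract (I J : choiceType) M :
  retract (dsum I (dsum J M)) (dsum (I * J)%type M).
Proof.
have [phi phiE] := choice (fun i : I => dsum_lift_exists
  (fun j : J => dsum_in (i, j) : {linear M -> dsum (I * J)%type M})).
have [S SE] := dsum_lift_exists phi.
have [P PE] := dsum_lift_exists (fun ij : (I * J)%type =>
  dsum_in ij.1 \o dsum_in ij.2 : {linear M -> dsum I (dsum J M)}).
exists S, P => x; apply: (dsum_ext (f := P \o S) (g := idfun)) => i y /=.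
rewrite SE; apply: (dsum_ext (f := P \o phi i) (g := dsum_in i)) => j m /=.
by rewrite phiE PE.
Qed.

Lemma AddP T M : Add T M <-> exists I : choiceType, retract M (dsum I T).
Proof.
split=> [[I /summandP]|[I]]; last by exists I; exact/summandP.
by exists {classic I}.
Qed.

Lemma addP T M : add T M <-> exists n, retract M (dsum 'I_n T).
Proof. by split=> -[n /summandP]; exists n. Qed.

Lemma add_Add T M : add T M -> Add T M.
Proof. by move=> [n]; exists 'I_n. Qed.

Lemma Add_retract T M N : retract M N -> Add T N -> Add T M.
Proof. by move=> MN /AddP[I NI]; apply/AddP; exists I; exact: retract_trans NI. Qed.

Lemma Add_dsum T (I : choiceType) : Add T (dsum I T).
Proof. by apply/AddP; exists I; exact: retract_refl. Qed.

Lemma retract_dsum1 T (I : choiceType) : I -> retract T (dsum I T).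
Proof.
move=> i; have [e eE] := dsum_ev T i.
by exists (dsum_in i), e => x; rewrite eE dsum_inE eqxx.
Qed.

Lemma add_refl T : add T T.
Proof. by apply/addP; exists 1%N; exact: retract_dsum1 ord0. Qed.

Lemma Add_trans T T' M : Add T' T -> Add T M -> Add T' M.
Proof.
move=> /AddP[J TJ] /AddP[I MI]; apply/AddP; exists (I * J)%type.
apply: retract_trans MI _; apply: retract_trans (dsum_dsum_retract I J T').
exact: dsum_retract.
Qed.

Lemma projective_retract M N : retract M N -> projective N -> projective M.
Proof.
move=> [s [p sp]] pN U V g h g_surj.
have [k kE] := pN _ _ g (h \o p) g_surj.
by exists (k \o s) => x /=; rewrite kE /= sp.
Qed.

Lemma projective_prod M N : projective M -> projective N -> projective (M * N)%type.
Proof.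
move=> pM pN U V g h g_surj.
have [i iE] := linear_pair (idfun : {linear M -> M}) (\0 : {linear M -> N}).
have [j jE] := linear_pair (\0 : {linear N -> M}) (idfun : {linear N -> N}).
have [k kE] := pM _ _ g (h \o i) g_surj.
have [l lE] := pN _ _ g (h \o j) g_surj.
have [f fE] := linear_copair k l.
exists f => -[x y]; rewrite fE linearD kE lE /= -linearD iE jE.
by congr (h _); congr pair; rewrite /= ?addr0 ?add0r.
Qed.

Lemma dsum_projective_of (I : choiceType) M : projective M -> projective (dsum I M).
Proof.
move=> pM U V g h g_surj.
have [k kE] := choice (fun i : I => pM _ _ g (h \o dsum_in i) g_surj).
have [f fE] := dsum_lift_exists k.
exists f => x; apply: (dsum_ext (f := g \o f) (g := h)) => i m /=.
by rewrite fE kE.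
Qed.

Lemma Add_projective T M : projective T -> Add T M -> projective M.
Proof.
move=> pT /AddP[I MI]; apply: projective_retract MI _.
exact: dsum_projective_of.
Qed.

Lemma regular_projective : projective (A^o).
Proof.
apply: (@projective_retract _ (dsum unit A^o)); last exact: dsum_projective.
exact: retract_dsum1 tt.
Qed.

Lemma ext1_retract_l M M' N : retract M M' -> ext1_zero M' N -> ext1_zero M N.
Proof.
move=> [s [p sp]] eM X Y f g fg h.
have [k kE] := eM _ _ _ _ fg (h \o p).
by exists (k \o s) => x /=; rewrite kE /= sp.
Qed.

Lemma ext1_dsum_l (I : choiceType) M N : ext1_zero M N -> ext1_zero (dsum I M) N.
Proof.
move=> eM X Y f g fg h.
have [k kE] := choice (fun i : I => eM _ _ _ _ fg (h \o dsum_in i)).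
have [F FE] := dsum_lift_exists k.
exists F => x; apply: (dsum_ext (f := g \o F) (g := h)) => i m /=.
by rewrite FE kE.
Qed.

Lemma ext1_Add T M N : Add T M -> ext1_zero T N -> ext1_zero M N.
Proof.
by move=> /AddP[I MI] eT; apply: ext1_retract_l MI _; exact: ext1_dsum_l.
Qed.

Lemma ext1_prod_l M M' N : ext1_zero M N -> ext1_zero M' N -> ext1_zero (M * M')%type N.
Proof.
move=> eM eM' X Y f g fg h.
have [i iE] := linear_pair (idfun : {linear M -> M}) (\0 : {linear M -> M'}).
have [j jE] := linear_pair (\0 : {linear M' -> M}) (idfun : {linear M' -> M'}).
have [k kE] := eM _ _ _ _ fg (h \o i).
have [l lE] := eM' _ _ _ _ fg (h \o j).
have [F FE] := linear_copair k l.
exists F => -[x y]; rewrite FE linearD kE lE /= -linearD iE jE.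
by congr (h _); congr pair; rewrite /= ?addr0 ?add0r.
Qed.

Lemma extends_retract U V (a : {linear U -> V}) N N' :
  retract N N' -> extends a N' -> extends a N.
Proof.
move=> [s [p sp]] eN h; have [k kE] := eN (s \o h).
by exists (p \o k) => x /=; rewrite kE /= sp.
Qed.

Lemma ext1_retract_r C N N' : retract N N' -> ext1_zero C N' -> ext1_zero C N.
Proof.
move=> NN' eN; have kerC := short_exact_ker (@cover_surj A C).
apply: (extends_ext1 kerC); first exact/projective_ext1/dsum_projective.
exact: extends_retract NN' (ext1_extends kerC eN).
Qed.

(** Finite generation as an induction principle over a finite list, which avoids writing elements as
    linear combinations. *)
Definition fin_gen M : Prop :=
  exists s : seq M, forall D : M -> Prop,
    D 0 -> (forall x y, D x -> D y -> D (x + y)) ->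
    (forall a x, D x -> D (a *: x)) ->
    (forall x, x \in s -> D x) -> forall x, D x.

Lemma fin_gen_surj M N (p : {linear M -> N}) : surj p -> fin_gen M -> fin_gen N.
Proof.
move=> p_surj [s sP]; exists (map p s) => D D0 DD DZ Ds y.
have [x <-] := p_surj y; apply: (sP (D \o p)) => /= [|x1 x2|a x1|x1 x1s].
- by rewrite linear0.
- by rewrite linearD; exact: DD.
- by rewrite linearZ; exact: DZ.
- by apply: Ds; exact: map_f.
Qed.

Lemma fin_gen_retract M N : retract M N -> fin_gen N -> fin_gen M.
Proof. by move=> [s [p sp]]; apply: (fin_gen_surj (p := p)) => x; exists (s x). Qed.

Lemma fin_gen_dsum n M : fin_gen M -> fin_gen (dsum 'I_n M).
Proof.
move=> [s sP]; exists [seq dsum_in i x | i <- enum 'I_n, x <- s] => D D0 DD DZ Ds.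
apply: dsum_ind => // i; apply: (sP (D \o dsum_in i)) => /= [|x1 x2|a x1|x1 x1s].
- by rewrite linear0.
- by rewrite linearD; exact: DD.
- by rewrite linearZ; exact: DZ.
- by apply: Ds; apply: allpairs_f => //; rewrite mem_enum.
Qed.

Lemma fin_gen_add T M : add T M -> fin_gen T -> fin_gen M.
Proof.
by move=> /addP[n Mn] fT; apply: fin_gen_retract Mn _; exact: fin_gen_dsum.
Qed.

Lemma fin_gen_regular : fin_gen A^o.
Proof.
exists [:: 1] => D _ _ DZ D1 x; rewrite -[x]mulr1; apply: DZ.
by apply: D1; rewrite inE.
Qed.

Lemma fin_gen_supp (I : choiceType) M N (h : {linear M -> dsum I N}) :
  fin_gen M -> exists s : {fset I}, forall x i, h x i != 0 -> i \in s.
Proof.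
move=> [s sP]; exists (\bigcup_(x <- s) dsum_supp (h x))%fset => x i.
apply: contraNT => si; apply/eqP; move: x.
apply: (sP (fun x => h x i = 0)) => [|x y hx hy|a x hx|x xs].
- by rewrite linear0.
- by rewrite linearD [LHS](_ : _ = h x i + h y i) // hx hy addr0.
- by rewrite linearZ [LHS](_ : _ = a *: h x i) // hx scaler0.
- apply/eqP; apply: contraNT si; rewrite -dsum_suppP => hxi.
  by apply/bigfcupP; exists x => //; rewrite xs.
Qed.

(** Only the finitely many coordinates reached by [h] matter; [p] puts the finite power back along
    an enumeration of them. *)
Lemma fin_gen_factor T (I : choiceType) M (h : {linear M -> dsum I T}) :
  fin_gen M -> exists n (k : {linear M -> dsum 'I_n T})
    (p : {linear dsum 'I_n T -> dsum I T}), forall x, p (k x) = h x.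
Proof.
move=> /fin_gen_supp - /(_ I T h)[s sP].
pose t := enum_fset s.
have [e eE] := choice (fun i : I => dsum_ev T i).
pose g := tnth (in_tuple t).
have [p pE] := dsum_lift_exists (fun i : 'I_(size t) =>
  dsum_in (g i) : {linear T -> dsum I T}).
have [k kE] : exists k : {linear M -> dsum 'I_(size t) T}, forall x,
    k x = \sum_(i < size t) dsum_in i (h x (g i)).
  apply: linear_of => a x y; rewrite scaler_sumr -big_split; apply: eq_bigr => i _ /=.
  by rewrite -!eE -linearP; congr (dsum_in i _); rewrite !linearP.
exists (size t), k, p => x; rewrite kE linear_sum [RHS](dsumE (s := s)); last exact: sP.
under eq_bigr do rewrite pE.
by rewrite [RHS](big_tnth) /=; apply: eq_bigr.
Qed.

Lemma add_of_Add T M : fin_gen M -> Add T M -> add T M.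
Proof.
move=> fM /AddP[I [s [q sq]]]; have [n [k [p pk]]] := fin_gen_factor s fM.
by apply/addP; exists n, k, (q \o p) => x /=; rewrite pk sq.
Qed.

End Toolkit.

(** * Ext *)

Section ExtTheory.
Variable A : pzRingType.
Implicit Types U V W X Y K L M N C T : lmodType A.

(** Shifts [res_ker] by one, so that index 0 is M itself and each n gives a sequence [0 -> res_syz P
    n.+1 -> P n -> res_syz P n -> 0]. *)
Definition res_syz M (P : resolution M) (n : nat) : lmodType A :=
  if n is m.+1 then res_ker P m else M.

Lemma res_syz_exact M (P : resolution M) :
  exists (i : forall n, {linear res_syz P n.+1 -> P n})
         (p : forall n, {linear P n -> res_syz P n}),
    (forall n, short_exact (i n) (p n)) /\
    (forall n x, res_d P n x = i n (p n.+1 x)).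
Proof.
pose i n : {linear res_syz P n.+1 -> P n} :=
  match n return {linear res_syz P n.+1 -> P n} with
  | 0 => (val : kernel (res_aug P) -> P 0%N)
  | m.+1 => (val : kernel (res_d P m) -> P m.+1)
  end.
have i_inj n : injective (i n) by case: n => [|n] x y /val_inj.
have iP n : forall y, (exists x, i n x = y) <-> exists x, res_d P n x = y.
  case: n => [|n] y /=.
  - rewrite -(@res_exact0 _ _ P y); split=> [[x <-]|y0]; first exact/eqP/(valP x).
    have yk : y \in ker_pred (res_aug P) by apply/eqP.
    by exists (Kernel yk).
  - rewrite -(@res_exactS _ _ P n y); split=> [[x <-]|y0]; first exact/eqP/(valP x).
    have yk : y \in ker_pred (res_d P n) by apply/eqP.
    by exists (Kernel yk).
have [q qE] : exists q : forall n, {linear P n.+1 -> res_syz P n.+1},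
    forall n x, i n (q n x) = res_d P n x.
  have qn n : exists q : {linear P n.+1 -> res_syz P n.+1},
      forall x, i n (q x) = res_d P n x.
    by apply: corestrict (i_inj n) _ => x; apply/iP; exists x.
  exists (fun n => projT1 (cid (qn n))) => n x; exact: (projT2 (cid (qn n)) x).
pose p n : {linear P n -> res_syz P n} :=
  match n return {linear P n -> res_syz P n} with
  | 0 => res_aug P
  | m.+1 => q m
  end.
exists i, p; split=> [n|n x]; last by rewrite qE.
split=> //.
- move=> y; rewrite iP; case: n y => [|n] y; first exact: res_exact0.
  rewrite -res_exactS -qE /=; split=> [->|]; first by rewrite linear0.
  by move=> /eqP; rewrite -[X in _ == X](linear0 (i n)) => /eqP /i_inj.
- case: n => [|n] y; first exact: res_surj.
  have /iP[x xE] : exists x, i n x = i n y by exists y.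
  by exists x; apply: i_inj; rewrite qE.
Qed.

(** Dimension shifting: a cocycle on $P_{n+1}$ is a map from the syzygy inside $P_n$, and it is a
    coboundary exactly when that map extends to $P_n$. *)
Lemma cocycle_coboundaryP M N (P : resolution M) n :
  (forall i, projective (P i)) ->
  (forall f : {linear P n.+1 -> N}, cocycle f -> coboundary f) <->
  ext1_zero (res_syz P n) N.
Proof.
move=> pP; have [i [p [ip dE]]] := res_syz_exact P.
split=> [H|H f fc].
  apply: (extends_ext1 (ip n) (projective_ext1 (pP n))) => h.
  have [|g gE] := H (h \o p n.+1).
    by move=> x; rewrite dE /= (short_exact_comp0 (ip n.+1)) linear0.
  exists g => x; have [_ _ /(_ x)[y <-]] := ip n.+1.
  by rewrite -dE -gE.
have [_ ex p_surj] := ip n.+1.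
have [|h hE] := @descend _ _ _ _ (p n.+1) f p_surj.
  move=> x /ex[y <-]; have [_ _ /(_ y)[z <-]] := ip n.+2.
  by rewrite -dE fc.
have [g gE] := ext1_extends (ip n) H h.
by exists g => x; rewrite dE gE hE.
Qed.

(* The identity of X' is the sum of a map factoring through Z' and one
   factoring through P. *)
Lemma syzygy_retract (X X' P Z Z' G : lmodType A)
    (i : {linear X' -> P}) (q : {linear P -> X})
    (j : {linear Z' -> G}) (r : {linear G -> Z}) :
  short_exact i q -> short_exact j r -> projective P -> projective G ->
  retract X Z -> retract X' (Z' * P)%type.
Proof.
move=> iq jr pP pG [s [p sp]].
have [[i_inj iqE q_surj] [j_inj jrE r_surj]] := (iq, jr).
have [S SE] := pP _ _ r (s \o q) r_surj.
have [Q QE] := pG _ _ q (p \o r) q_surj.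
have [|s' s'E] := @corestrict _ _ _ _ j (S \o i) j_inj.
  by move=> x; apply/jrE; rewrite SE /= (short_exact_comp0 iq) linear0.
have [|p' p'E] := @corestrict _ _ _ _ i (Q \o j) i_inj.
  by move=> x; apply/iqE; rewrite QE /= (short_exact_comp0 jr) linear0.
have [|t tE] := @corestrict _ _ _ _ i (idfun \- (Q \o S)) i_inj.
  by move=> x; apply/iqE; rewrite linearB /= QE /= SE /= sp subrr.
have [u uE] := linear_pair s' i; have [v vE] := linear_copair p' t.
exists u, v => x; rewrite uE vE /=; apply: i_inj.
by rewrite linearD p'E tE /= s'E addrC subrK.
Qed.

Lemma short_exact_dsum (I : choiceType) K L M (f : {linear K -> L}) (g : {linear L -> M}) :
  short_exact f g -> exists (F : {linear dsum I K -> dsum I L})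
    (G : {linear dsum I L -> dsum I M}), short_exact F G.
Proof.
move=> fg; have [f_inj fgE g_surj] := fg.
have [F FE] := dsum_map_exists I f; have [G GE] := dsum_map_exists I g.
have F_inj : injective F.
  by move=> x y xy; apply: dsum_eqP => i; apply: f_inj; rewrite -!FE xy.
exists F, G; split=> // y.
  split=> [Gy|[x <-]]; last first.
    by apply: dsum_eqP => i; rewrite GE FE (short_exact_comp0 fg).
  have /choice[x xE] i : exists z, f z = y i by apply/fgE; rewrite -GE Gy.
  exists (\sum_(i <- dsum_supp y) dsum_in i (x i)).
  rewrite linear_sum [RHS](dsumE (s := dsum_supp y)) => [|i]; last by rewrite dsum_suppP.
  apply: eq_bigr => i _; apply: dsum_eqP => j; rewrite FE !dsum_inE.
  by case: ifP => _; rewrite ?linear0.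
elim/(@dsum_ind A): y => [|x y [x' <-] [y' <-]|i m].
- by exists 0; rewrite linear0.
- by exists (x' + y'); rewrite linearD.
- have [l <-] := g_surj m; exists (dsum_in i l); apply: dsum_eqP => j.
  by rewrite GE !dsum_inE; case: ifP => _; rewrite ?linear0.
Qed.

Lemma short_exact_prod1 (F K L M : lmodType A) (f : {linear K -> L}) (g : {linear L -> M}) :
  short_exact f g -> exists (f' : {linear K -> (L * F)%type})
    (g' : {linear (L * F)%type -> (M * F)%type}), short_exact f' g'.
Proof.
move=> fg; have [f_inj fgE g_surj] := fg.
have [f' f'E] := linear_pair f (\0 : {linear K -> F}).
have [g' g'E] := linear_pair (g \o (fst : {linear (L * F)%type -> L}))
  (snd : {linear (L * F)%type -> F}).
exists f', g'; split.
- by move=> x y; rewrite !f'E => -[/f_inj].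
- move=> [l z]; rewrite g'E /=; split=> [[/fgE[x <-] ->]|[x]]; first by exists x; rewrite f'E.
  by rewrite f'E => -[<- <-]; rewrite (short_exact_comp0 fg).
- by move=> [m z]; have [l <-] := g_surj m; exists (l, z); rewrite g'E.
Qed.

Lemma Ext_zero_ext1 n M N (P : resolution M) :
  (forall i, projective (P i)) -> Ext_zero n.+1 M N -> ext1_zero (res_syz P n) N.
Proof. by move=> pP eM; apply/cocycle_coboundaryP => //; exact: eM. Qed.

(** An iterated Schanuel argument; the projective factor F does not affect the vanishing of
    $\mathrm{Ext}^1$. It yields both the independence of the resolution and the passage from $T'$ to
    $\mathrm{Add}(T')$. *)
Lemma res_syz_retract (I : choiceType) M M' (P : resolution M) (Q : resolution M') n :
  (forall i, projective (P i)) -> (forall i, projective (Q i)) ->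
  retract M (dsum I M') ->
  exists2 F, projective F & retract (res_syz P n) (dsum I (res_syz Q n) * F)%type.
Proof.
move=> pP pQ MM'.
have [i [p [ip _]]] := res_syz_exact P; have [j [q [jq _]]] := res_syz_exact Q.
elim: n => [|n [F pF PQ]].
  exists (dsum void A^o); first exact: dsum_projective.
  apply: retract_trans MM' _.
  have [s sE] := linear_pair (idfun : {linear dsum I M' -> dsum I M'})
    (\0 : {linear dsum I M' -> dsum void A^o}).
  by exists s, fst => x; rewrite sE.
exists (P n); first exact: pP.
have [f [g fg]] := short_exact_dsum I (jq n).
have [f' [g' fg']] := short_exact_prod1 F fg.
apply: syzygy_retract (ip n) fg' (pP n) _ PQ.
exact/projective_prod/pF/dsum_projective_of.
Qed.

Lemma Ext_zero_of_ext1 n (I : choiceType) M M' N (Q : resolution M') :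
  (forall i, projective (Q i)) -> retract M (dsum I M') ->
  ext1_zero (res_syz Q n) N -> Ext_zero n.+1 M N.
Proof.
move=> pQ MM' eQ P pP; apply/cocycle_coboundaryP => //.
have [F pF] := res_syz_retract n pP pQ MM'.
move=> /ext1_retract_l; apply; apply: ext1_prod_l; first exact: ext1_dsum_l.
exact: projective_ext1.
Qed.

Lemma Ext_zeroP n M N (P : resolution M) : (forall i, projective (P i)) ->
  Ext_zero n.+1 M N <-> ext1_zero (res_syz P n) N.
Proof.
move=> pP; split; first exact: Ext_zero_ext1.
by apply: (Ext_zero_of_ext1 (I := unit)) => //; exact: retract_dsum1 tt.
Qed.

Lemma Ext_zero1P M N : Ext_zero 1 M N <-> ext1_zero M N.
Proof. by have [P pP] := projective_resolution M; exact: Ext_zeroP pP. Qed.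

Lemma Ext_zero_Add n T T' N : Add T' T -> Ext_zero n.+1 T' N -> Ext_zero n.+1 T N.
Proof.
move=> /AddP[I TI]; have [P pP] := projective_resolution T'.
by move=> /(Ext_zero_ext1 pP); exact: (Ext_zero_of_ext1 pP TI).
Qed.

(** A map from a finitely generated module reaches finitely many coordinates, so the coordinatewise
    extensions over these can be summed. *)
Lemma extends_dsum (I : choiceType) U V (a : {linear U -> V}) N :
  fin_gen U -> extends a N -> extends a (dsum I N).
Proof.
move=> fU eN h; have [s sP] := fin_gen_supp h fU.
have [e eE] := choice (fun i : I => dsum_ev N i).
have [g gE] := choice (fun i => eN (e i \o h)).
have [k kE] : exists k : {linear V -> dsum I N}, forall x,
    k x = \sum_(i <- s) dsum_in i (g i x).
  apply: linear_of => c x y; rewrite scaler_sumr -big_split; apply: eq_bigr => i _ /=.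
  by rewrite !linearP.
exists k => x; rewrite kE [RHS](dsumE (sP x)); apply: eq_bigr => i _.
by rewrite gE /= eE.
Qed.

Lemma Ext_zero_dsum n (I : choiceType) M N (P : resolution M) :
  (forall i, projective (P i)) -> (forall i, fin_gen (P i)) ->
  Ext_zero n.+1 M N -> Ext_zero n.+1 M (dsum I N).
Proof.
move=> pP fP; rewrite !(Ext_zeroP _ _ pP) => eN.
have [i [p [ip _]]] := res_syz_exact P.
apply: (extends_ext1 (ip n) (projective_ext1 (pP n))); apply: extends_dsum.
  by have [_ _ p_surj] := ip n.+1; exact: fin_gen_surj p_surj (fP n.+1).
exact: ext1_extends (ip n) eN.
Qed.

Lemma Ext_zero_retract_r n M N N' : retract N N' -> Ext_zero n.+1 M N' -> Ext_zero n.+1 M N.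
Proof.
move=> NN'; have [P pP] := projective_resolution M.
by rewrite !(Ext_zeroP _ _ pP); exact: ext1_retract_r.
Qed.

(** A map from K to N lifts to M by $\mathrm{Ext}^1(K,L)=0$, the lift extends to Q by
    $\mathrm{Ext}^1(C,M)=0$, and [g] brings it back. For projective Q this is exactness of
    $\mathrm{Ext}^1(C,M)\to\mathrm{Ext}^1(C,N)\to\mathrm{Ext}^2(C,L)$. *)
Lemma ext1_cokernel (K Q C L M N : lmodType A) (i : {linear K -> Q}) (q : {linear Q -> C})
    (f : {linear L -> M}) (g : {linear M -> N}) :
  short_exact i q -> short_exact f g -> ext1_zero Q N ->
  ext1_zero K L -> ext1_zero C M -> ext1_zero C N.
Proof.
move=> iq fg eQ eK eC; apply: (extends_ext1 iq eQ) => h.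
have [h' h'E] := eK _ _ _ _ fg h.
have [k kE] := ext1_extends iq eC h'.
by exists (g \o k) => x /=; rewrite kE h'E.
Qed.

(** Extend $f h$ to [k : V -> M]. The image of [k] in N vanishes on U, hence comes from C, extends
    to $V'$ and lifts to M; subtracting this lift pushes [k] into L. Applied to consecutive terms of
    a resolution or coresolution, it passes lifting conditions to kernels. *)
Lemma extends_kernel U V C V' L M N (a : {linear U -> V}) (q : {linear V -> C})
    (b : {linear C -> V'}) (f : {linear L -> M}) (g : {linear M -> N}) :
  short_exact a q -> short_exact f g -> extends a M -> extends b N ->
  (forall h : {linear V' -> N}, exists k : {linear V' -> M}, forall x, g (k x) = h x) ->
  extends a L.
Proof.
move=> aq fg eM eN liftV h; have [[a_inj aqE q_surj] [f_inj fgE g_surj]] := (aq, fg).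
have [k kE] := eM (f \o h).
have [|h1 h1E] := @descend _ _ _ _ q (g \o k) q_surj.
  by move=> x /aqE[y <-] /=; rewrite kE /= (short_exact_comp0 fg).
have [h2 h2E] := eN h1; have [h3 h3E] := liftV h2.
have [|l lE] := @corestrict _ _ _ _ f (k \- (h3 \o b \o q)) f_inj.
  by move=> x; apply/fgE; rewrite linearB /= h3E h2E h1E subrr.
exists l => x; apply: f_inj; rewrite lE /= kE (short_exact_comp0 aq).
by rewrite !linear0 addr0.
Qed.

(** The segment $\mathrm{Hom}(C,M)\to\mathrm{Hom}(C,N)\to\mathrm{Ext}^1(C,L)\to\mathrm{Ext}^1(C,M)$:
    surjectivity on Hom, the precover property, kills the third term. *)
Lemma ext1_precover C L M N (f : {linear L -> M}) (g : {linear M -> N}) :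
  short_exact f g -> ext1_zero C M ->
  (forall h : {linear C -> N}, exists k : {linear C -> M}, forall x, g (k x) = h x) ->
  ext1_zero C L.
Proof.
move=> fg eM liftC; have kerC := short_exact_ker (@cover_surj A C).
apply: (extends_ext1 kerC); first exact/projective_ext1/dsum_projective.
apply: (extends_kernel (b := (idfun : {linear C -> C})) kerC fg) => //.
- exact: ext1_extends kerC eM.
- by move=> h; exists h.
Qed.

(** Since $C'$ is a syzygy of $C''$, this is exactness of
    $\mathrm{Ext}^1(C'',N)\to\mathrm{Ext}^2(C'',L)\to\mathrm{Ext}^2(C'',M)$, with
    $\mathrm{Ext}^2(C'',-)$ read as $\mathrm{Ext}^1(C',-)$. *)
Lemma ext1_kernel L M N C C' V V' (a : {linear C -> V}) (q : {linear V -> C'})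
    (a' : {linear C' -> V'}) C'' (q' : {linear V' -> C''})
    (f : {linear L -> M}) (g : {linear M -> N}) :
  short_exact a q -> short_exact a' q' -> short_exact f g ->
  projective V -> projective V' ->
  ext1_zero C' M -> ext1_zero C'' N -> ext1_zero C' L.
Proof.
move=> aq aq' fg pV pV' eM eN; apply: (extends_ext1 aq (projective_ext1 pV)).
apply: (extends_kernel (b := a') aq fg).
- exact: ext1_extends aq eM.
- exact: ext1_extends aq' eN.
- by move=> h; apply: pV'; case: fg.
Qed.

End ExtTheory.

(** * Resolutions and coresolutions by coinduction *)

Section Splicing.
Variable A : pzRingType.
Implicit Types U V W X Y K L M N C T : lmodType A.

Lemma ker_retract U V W (f : {linear U -> V}) (g : {linear V -> W}) :
  injective f -> exact_at f g -> retract (kernel g) U.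
Proof.
move=> f_inj fgE.
have v_inj : injective (val : {linear kernel g -> V}) by move=> x y /val_inj.
have [|s sE] := @corestrict _ _ _ _ f (val : kernel g -> V) f_inj.
  by move=> x; apply/fgE/eqP/(valP x).
have [|p pE] := @corestrict _ _ _ _ (val : kernel g -> V) f v_inj.
  move=> x; have xk : f x \in ker_pred g by apply/eqP/fgE; exists x.
  by exists (Kernel xk).
by exists s, p => x; apply: v_inj; rewrite pE sE.
Qed.

Lemma coker_retract U V W (f : {linear U -> V}) (g : {linear V -> W}) :
  exact_at f g -> surj g -> retract (cokernel f) W.
Proof.
move=> fgE g_surj; have c_surj := @coker_proj_surj _ _ _ f.
have cP x : coker_proj f x = 0 <-> exists y, f y = x.
  by rewrite -[X in _ = X](linear0 (@coker_proj _ _ _ f)) coker_projP subr0.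
have [|s sE] := @descend _ _ _ _ (@coker_proj _ _ _ f) g c_surj.
  by move=> x /cP /fgE.
have [|p pE] := @descend _ _ _ _ g (@coker_proj _ _ _ f) g_surj.
  by move=> x /fgE /cP.
by exists s, p => z; have [x <-] := c_surj z; rewrite sE pE.
Qed.

Section Resolve.
Variables B D E : lmodType A -> Prop.

(** [B] is asked of the middle term, [D] is the invariant that lets the construction go on, and [E]
    is what is to be known of every kernel. *)
Record left_step M := LeftStep {
  ls_ker : lmodType A; ls_obj : lmodType A;
  ls_f : {linear ls_ker -> ls_obj}; ls_g : {linear ls_obj -> M};
  ls_exact : short_exact ls_f ls_g; ls_B : B ls_obj;
  ls_D : D ls_ker; ls_E : E ls_ker }.

Hypothesis step : forall M, D M -> exists _ : left_step M, True.

Lemma resolution_coind M : D M -> exists P : resolution M,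
  (forall i, B (P i)) /\ forall i, exists2 K, retract (res_ker P i) K & E K.
Proof.
move=> DM.
(* The iteration runs over modules bundled with a proof of [D], so that a next step can always be
   chosen. *)
pose st (s : {M | D M}) : left_step (sval s) := projT1 (cid (step (svalP s))).
pose nxt (s : {M | D M}) : {M | D M} := exist _ (ls_ker (st s)) (ls_D (st s)).
pose ch n := iter n nxt (exist _ M DM).
pose d n : {linear ls_obj (st (ch n.+1)) -> ls_obj (st (ch n))} :=
  ls_f (st (ch n)) \o ls_g (st (ch n.+1)).
have f_inj n : injective (ls_f (st (ch n))) by case: (ls_exact (st (ch n))).
have g_surj n : surj (ls_g (st (ch n))) by case: (ls_exact (st (ch n))).
have fg n : exact_at (ls_f (st (ch n))) (ls_g (st (ch n))) by case: (ls_exact (st (ch n))).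
have dg n : exact_at (d n) (ls_g (st (ch n))).
  move=> y; rewrite fg; split=> [[x <-]|[x <-]]; last by exists (ls_g (st (ch n.+1)) x).
  by have [z <-] := g_surj n.+1 x; exists z.
have d0 n x : d n x = 0 <-> ls_g (st (ch n.+1)) x = 0.
  rewrite /d /=; split=> [|->]; last by rewrite linear0.
  by move=> /eqP; rewrite -[X in _ == X](linear0 (ls_f (st (ch n)))) => /eqP /f_inj.
have dd n : exact_at (d n.+1) (d n) by move=> y; rewrite d0; exact: dg.
pose P := @Resolution A M (fun n => ls_obj (st (ch n))) (ls_g (st (ch 0%N))) d
  (g_surj 0%N) (dg 0%N) dd.
exists P; split=> i; first exact: ls_B.
exists (ls_ker (st (ch i))); last exact: ls_E.
case: i => [|i] /=; first exact: ker_retract (@f_inj 0%N) (fg 0%N).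
by apply: ker_retract (@f_inj i.+1) _ => y; rewrite d0; exact: fg.
Qed.

End Resolve.

Section Coresolve.
Variables B D E : lmodType A -> Prop.

Record right_step M := RightStep {
  rs_coker : lmodType A; rs_obj : lmodType A;
  rs_f : {linear M -> rs_obj}; rs_g : {linear rs_obj -> rs_coker};
  rs_exact : short_exact rs_f rs_g; rs_B : B rs_obj;
  rs_D : D rs_coker; rs_E : E rs_coker }.

Hypothesis step : forall M, D M -> exists _ : right_step M, True.

Lemma coresolution_coind M : D M -> exists P : coresolution M,
  (forall i, B (P i)) /\ forall i, exists2 K, retract (cores_coker P i) K & E K.
Proof.
move=> DM.
pose st (s : {M | D M}) : right_step (sval s) := projT1 (cid (step (svalP s))).
pose nxt (s : {M | D M}) : {M | D M} := exist _ (rs_coker (st s)) (rs_D (st s)).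
pose ch n := iter n nxt (exist _ M DM).
pose d n : {linear rs_obj (st (ch n)) -> rs_obj (st (ch n.+1))} :=
  rs_f (st (ch n.+1)) \o rs_g (st (ch n)).
have f_inj n : injective (rs_f (st (ch n))) by case: (rs_exact (st (ch n))).
have g_surj n : surj (rs_g (st (ch n))) by case: (rs_exact (st (ch n))).
have fg n : exact_at (rs_f (st (ch n))) (rs_g (st (ch n))) by case: (rs_exact (st (ch n))).
have d0 n x : d n x = 0 <-> rs_g (st (ch n)) x = 0.
  rewrite /d /=; split=> [|->]; last by rewrite linear0.
  by move=> /eqP; rewrite -[X in _ == X](linear0 (rs_f (st (ch n.+1)))) => /eqP /(@f_inj n.+1).
have fd n : exact_at (rs_f (st (ch n))) (d n) by move=> y; rewrite d0; exact: fg.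
have dg n : exact_at (d n) (rs_g (st (ch n.+1))).
  move=> y; rewrite fg; split=> [[x <-]|[x <-]]; last by exists (rs_g (st (ch n)) x).
  by have [z <-] := g_surj n x; exists z.
have dd n : exact_at (d n) (d n.+1) by move=> y; rewrite d0; exact: dg.
pose P := @Coresolution A M (fun n => rs_obj (st (ch n))) (rs_f (st (ch 0%N))) d
  (@f_inj 0%N) (fd 0%N) dd.
exists P; split=> i; first exact: rs_B.
exists (rs_coker (st (ch i))); last exact: rs_E.
case: i => [|i] /=; first exact: coker_retract (fg 0%N) (@g_surj 0%N).
exact: coker_retract (dg i) (@g_surj i.+1).
Qed.

End Coresolve.

Definition cores_syz M (D : coresolution M) (n : nat) : lmodType A :=
  if n is m.+1 then cores_coker D m else M.

Lemma cores_syz_exact M (D : coresolution M) :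
  exists (a : forall n, {linear cores_syz D n -> D n})
         (q : forall n, {linear D n -> cores_syz D n.+1}),
    forall n, short_exact (a n) (q n).
Proof.
pose q n : {linear D n -> cores_syz D n.+1} :=
  match n return {linear D n -> cores_syz D n.+1} with
  | 0 => @coker_proj _ _ _ (cores_aug D)
  | m.+1 => @coker_proj _ _ _ (cores_d D m)
  end.
have cP U V (f : {linear U -> V}) x : coker_proj f x = 0 <-> exists y, f y = x.
  by rewrite -[X in _ = X](linear0 (@coker_proj _ _ _ f)) coker_projP subr0.
have q_surj n : surj (q n) by case: n => [|n] y; exact: coker_proj_surj.
have qd n x : q n x = 0 <-> cores_d D n x = 0.
  case: n x => [|n] x; first by rewrite cP -(@cores_exact0 _ _ D x).
  by rewrite cP -(@cores_exactS _ _ D n x).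
have bn n : exists b : {linear cores_syz D n.+1 -> D n.+1},
    forall x, b (q n x) = cores_d D n x.
  by apply: descend (@q_surj n) _ => x /qd.
pose b n := projT1 (cid (bn n)).
have bE n : forall x, b n (q n x) = cores_d D n x := projT2 (cid (bn n)).
pose a n : {linear cores_syz D n -> D n} :=
  match n return {linear cores_syz D n -> D n} with
  | 0 => cores_aug D
  | m.+1 => b m
  end.
exists a, q => n; split=> //.
- case: n => [|n]; first exact: cores_inj.
  apply: inj0 => y /=; have [x <-] := q_surj n y.
  by rewrite bE => /qd.
- case: n => [|n] y; first exact: cP.
  rewrite cP; split=> [[x <-]|[z <-]]; first by exists (q n x); rewrite bE.
  by have [x <-] := q_surj n z; exists x; rewrite [RHS]bE.
Qed.

End Splicing.

(** * Coinduction principles for Gen* and cogen* *)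

Section GenStar.
Variable R : pzRingType.
Implicit Types T M N K L : rmodType R.

(** Splicing the given covers gives the resolution. Together with [Gen_star_step] this makes
    [Gen_star T] the greatest class stable under such covers. *)
Lemma Gen_star_coind T (D : rmodType R -> Prop) :
  (forall M, D M -> exists K T' (f : {linear K -> T'}) (g : {linear T' -> M}),
    [/\ short_exact f g, Add T T', ext1_zero T K & D K]) ->
  forall M, D M -> Gen_star T M.
Proof.
move=> step M DM.
have stepE N : D N -> exists _ : left_step (Add T) D (ext1_zero T) N, True.
  by move=> /step[K [T' [f [g [fg aT eK DK]]]]]; exists (LeftStep fg aT DK eK).
have [P [aP kP]] := resolution_coind stepE DM.
exists P; split=> // i; apply/Ext_zero1P.
by have [K PK] := kP i; exact: ext1_retract_r.
Qed.

Lemma cogen_star_coind T (D : rmodType R -> Prop) :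
  (forall M, D M -> exists L T' (f : {linear M -> T'}) (g : {linear T' -> L}),
    [/\ short_exact f g, add T T', ext1_zero L T & D L]) ->
  forall M, D M -> cogen_star T M.
Proof.
move=> step M DM.
have stepE N : D N -> exists _ : right_step (add T) D (fun K => ext1_zero K T) N, True.
  by move=> /step[C [T' [f [g [fg aT eC DC]]]]]; exists (RightStep fg aT DC eC).
have [P [aP kP]] := coresolution_coind stepE DM.
exists P; split=> // i; apply/Ext_zero1P.
by have [K PK] := kP i; exact: ext1_retract_l.
Qed.

Lemma Gen_star_step T M : Gen_star T M ->
  exists K T' (f : {linear K -> T'}) (g : {linear T' -> M}),
    [/\ short_exact f g, Add T T', ext1_zero T K & Gen_star T K].
Proof.
move=> [P [aP eP]]; have [i [p [ip dE]]] := res_syz_exact P.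
exists (res_syz P 1), (P 0%N), (i 0%N), (p 0%N); split=> //; first exact/Ext_zero1P/eP.
have [i_inj ex p_surj] := ip 1%N.
have ex0 : exact_at (res_d P 1) (p 1%N).
  move=> y; rewrite ex; split=> -[x <-]; last by exists (p 2 x); rewrite dE.
  by have [_ _ /(_ x)[z <-]] := ip 2; exists z; rewrite dE.
pose P' := @Resolution _ (res_syz P 1) (fun n => P n.+1) (p 1%N) (fun n => res_d P n.+1)
  p_surj ex0 (fun n => @res_exactS _ _ P n.+1).
exists P'; split=> [n|[|n]]; [exact: aP| |exact: (eP n.+2)].
(* The zeroth kernel of the shifted resolution is that of [p 1], not of a differential of [P], so it
   is compared with [res_syz P 2] up to a retract. *)
apply/Ext_zero1P; apply: (@ext1_retract_r _ _ _ (res_syz P 2)); last exact/Ext_zero1P/eP.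
exact: ker_retract i_inj ex.
Qed.

End GenStar.

(** * Preenvelopes for injectivity classes *)

(** Provides representatives for colimit elements: the entries below n are zero, and compatibility
    is required only from n on. *)
Lemma compatible_seq (A : pzRingType) (M : nat -> lmodType A)
    (u : forall n, {linear M n -> M n.+1}) n (x : M n) :
  exists s : forall k, M k, s n = x /\ forall k, (n <= k)%N -> s k.+1 = u k (s k).
Proof.
elim: n M u x => [|n IH] M u x.
  by exists (nat_rect M x (fun k y => u k y)).
have [s [sn sE]] := IH (fun k => M k.+1) (fun k => u k.+1) x.
exists (fun k => if k is m.+1 return M k then s m else 0); split=> // -[|k] //.
exact: sE.
Qed.

(** * Colimits of sequences of injections *)

Section SequenceModule.
Variables (A : pzRingType) (M : nat -> lmodType A).

Definition seqmod : Type := forall n, M n.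
HB.instance Definition _ := gen_eqMixin seqmod.
HB.instance Definition _ := gen_choiceMixin seqmod.

Implicit Types s t : seqmod.
Definition seqmod_add s t : seqmod := fun n => s n + t n.
Definition seqmod_opp s : seqmod := fun n => - s n.
Definition seqmod_scale (a : A) s : seqmod := fun n => a *: s n.

Lemma seqmod_addA : associative seqmod_add.
Proof. by move=> s t r; apply: functional_extensionality_dep => n; exact: addrA. Qed.
Lemma seqmod_addC : commutative seqmod_add.
Proof. by move=> s t; apply: functional_extensionality_dep => n; exact: addrC. Qed.
Lemma seqmod_add0 : left_id (fun n => 0 : M n) seqmod_add.
Proof. by move=> s; apply: functional_extensionality_dep => n; exact: add0r. Qed.
Lemma seqmod_addN : left_inverse (fun n => 0 : M n) seqmod_opp seqmod_add.
Proof. by move=> s; apply: functional_extensionality_dep => n; exact: addNr. Qed.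

HB.instance Definition _ := GRing.isZmodule.Build seqmod
  seqmod_addA seqmod_addC seqmod_add0 seqmod_addN.

Lemma seqmod_scaleA a b s : seqmod_scale a (seqmod_scale b s) = seqmod_scale (a * b) s.
Proof. by apply: functional_extensionality_dep => n; exact: scalerA. Qed.
Lemma seqmod_scale1 : left_id 1 seqmod_scale.
Proof. by move=> s; apply: functional_extensionality_dep => n; exact: scale1r. Qed.
Lemma seqmod_scaleDr : right_distributive seqmod_scale +%R.
Proof. by move=> a s t; apply: functional_extensionality_dep => n; exact: scalerDr. Qed.
Lemma seqmod_scaleDl s : {morph seqmod_scale^~ s : a b / a + b}.
Proof. by move=> a b; apply: functional_extensionality_dep => n; exact: scalerDl. Qed.

HB.instance Definition _ := GRing.Zmodule_isLmodule.Build A seqmod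
  seqmod_scaleA seqmod_scale1 seqmod_scaleDr seqmod_scaleDl.

End SequenceModule.

Section Colimit.
Variables (A : pzRingType) (M : nat -> lmodType A).
Variable u : forall n, {linear M n -> M n.+1}.
Hypothesis u_inj : forall n, injective (u n).

(* Eventually compatible sequences modulo eventually vanishing ones. *)
Lemma colimit_exists : exists (C : lmodType A) (j : forall n, {linear M n -> C}),
  [/\ forall n, injective (j n), forall n x, j n.+1 (u n x) = j n x
    & forall c, exists n x, j n x = c].
Proof.
pose compat n (s : seqmod M) := forall k, (n <= k)%N -> s k.+1 = u k (s k).
have compatD n s t : compat n s -> compat n t -> compat n (s + t).
  by move=> hs ht k nk; rewrite linearD -hs // -ht.
have compatZ n a s : compat n s -> compat n (a *: s).
  by move=> hs k nk; rewrite linearZ /= -hs.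
have compatW n m s : (n <= m)%N -> compat n s -> compat m s.
  by move=> nm hs k mk; apply: hs; exact: leq_trans mk.
have [||a x [n hn]|E [e [e_inj eP]]] := @submodule_exists A (seqmod M) (fun s => exists n, compat n s).
- by exists 0%N => k _; rewrite linear0.
- move=> s t [n hn] [m hm]; exists (maxn n m).
  by apply: compatD; [apply: compatW hn | apply: compatW hm]; rewrite ?leq_maxl ?leq_maxr.
- by exists n; exact: compatZ.
pose ev0 (v : E) := exists n, forall k, (n <= k)%N -> e v k = 0.
have eD v w k : e (v + w) k = e v k + e w k by rewrite linearD.
have eZ a v k : e (a *: v) k = a *: e v k by rewrite linearZ.
have eB v w k : e (v - w) k = e v k - e w k by rewrite linearB.
have [||a x [n hn]|Z [z [z_inj zP]]] := @submodule_exists A E ev0.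
- by exists 0%N => k _; rewrite linear0.
- move=> v w [n hn] [m hm]; exists (maxn n m) => k; rewrite geq_max => /andP[nk mk].
  by rewrite eD hn // hm // addr0.
- by exists n => k nk; rewrite eZ hn // scaler0.
have [_ zE pi_surj] := short_exact_coker z_inj.
set pi : {linear E -> cokernel z} := @coker_proj _ _ _ z in zE pi_surj.
have pi0 v : pi v = 0 <-> ev0 v by rewrite zE zP.
pose rep n (x : M n) v := e v n = x /\ compat n (e v).
have repK n v : compat n (e v) -> e v n = 0 -> forall k, (n <= k)%N -> e v k = 0.
  move=> cv v0; elim=> [|k IH]; first by rewrite leqn0 => /eqP <-.
  rewrite leq_eqVlt => /orP[/eqP<- //|nk].
  by rewrite cv // IH // linear0.
have rep_uniq n x v w : rep n x v -> rep n x w -> pi v = pi w.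
  move=> [vx cv] [wx cw]; apply/eqP; rewrite -subr_eq0 -linearB; apply/eqP/pi0.
  exists n; apply: repK; last by rewrite eB vx wx subrr.
  by move=> k nk; rewrite !eB cv // cw // linearB.
have repE n x : exists v, rep n x v.
  have [s [sx cs]] := compatible_seq u x.
  have [v vE] : exists v, e v = s by apply/eP; exists n.
  by exists v; rewrite /rep vE.
have jn n : exists j : {linear M n -> cokernel z}, forall x v, rep n x v -> j x = pi v.
  have [r rE] := choice (repE n).
  have [|j jE] := @linear_of A (M n) (cokernel z) (pi \o r).
    move=> a x y /=; rewrite -linearP; apply: (@rep_uniq n (a *: x + y)) => //.
    have [[rx cx] [ry cy]] := (rE x, rE y); split; first by rewrite eD eZ rx ry.
    by rewrite linearP; apply: compatD => //; exact: compatZ.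
  by exists j => x v hv; rewrite jE; exact: rep_uniq hv.
exists (cokernel z), (fun n => projT1 (cid (jn n))).
have jE n : forall x v, rep n x v -> projT1 (cid (jn n)) x = pi v := projT2 (cid (jn n)).
split=> [n|n x|c].
- apply: inj0 => x; have [v hv] := repE n x; rewrite (jE _ _ _ hv) => /pi0[m v0].
  case: hv => <- cv; have : e v (n + m)%N = 0 by apply: v0; exact: leq_addl.
  elim: m {v0} => [|m IH]; first by rewrite addn0.
  rewrite addnS cv ?leq_addr // => h; apply: IH.
  by apply: u_inj; rewrite h linear0.
- have [v hv] := repE n x; rewrite (jE _ _ _ hv); apply: jE.
  by case: hv => <- cv; split; [rewrite cv | exact: compatW cv].
- have [v <-] := pi_surj c; have [n cv] : exists n, compat n (e v) by apply/eP; exists v.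
  by exists n, (e v n); exact: jE.
Qed.

End Colimit.

Section Preenvelope.
Variables (A : pzRingType) (J : countType) (U V : J -> lmodType A).
Variable a : forall j, {linear U j -> V j}.
Hypotheses (a_inj : forall j, injective (a j)) (fU : forall j, fin_gen (U j)).
Implicit Types M N : lmodType A.

(** The pushout of a sum of copies of [a j], one for each map from [U j] to M, treats all these maps
    at once. A module injective relative to [a j] is so relative to the sum, hence relative to its
    pushout. *)
Lemma preenvelope_step j M : exists (M' : lmodType A) (f : {linear M -> M'}),
  [/\ injective f,
     forall h : {linear U j -> M}, exists k : {linear V j -> M'}, forall x, k (a j x) = f (h x)
   & forall N, extends (a j) N -> extends f N].
Proof.
pose I : choiceType := {classic {linear U j -> M}}.
have [aI aIE] := dsum_map_exists I (a j).
have aIin i x : aI (dsum_in i x) = dsum_in i (a j x).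
  by apply: dsum_eqP => l; rewrite aIE !dsum_inE; case: ifP => _; rewrite ?linear0.
have aI_inj : injective aI.
  by move=> x y xy; apply: dsum_eqP => i; apply: (@a_inj j); rewrite -!aIE xy.
have [H HE] := dsum_lift_exists (fun h : I => (h : {linear U j -> M})).
have [X [f [b [f_inj bE _ _ XU]]]] := pushout_exists H aI_inj.
exists X, f; split=> // [h|N eN g].
  by exists (b \o dsum_in (h : I)) => x /=; rewrite -aIin bE HE.
have [k kE] := choice (fun h : I => eN (g \o (h : {linear U j -> M}))).
have [w wE] := dsum_lift_exists k.
have [|l [lf _]] := XU N g w; last by exists l.
move=> x; apply: (dsum_ext (f := w \o aI) (g := g \o H)) => i m /=.
by rewrite aIin wE kE HE.
Qed.

Lemma preenvelope_step_opt (o : option J) M : exists (M' : lmodType A) (f : {linear M -> M'}),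
  [/\ injective f,
     forall j, o = Some j -> forall h : {linear U j -> M},
       exists k : {linear V j -> M'}, forall x, k (a j x) = f (h x)
   & forall N, (forall j, extends (a j) N) -> extends f N].
Proof.
case: o => [j|]; last first.
  (* An index that decodes to no map leaves the module unchanged. *)
  by exists M, idfun; split=> // N _ h; exists h.
have [M' [f [f_inj fh fN]]] := preenvelope_step j M.
by exists M', f; split=> // [_ [<-] //|N eN]; exact: fN.
Qed.

(* The small object argument: the domains are finitely generated and all maps
   are injective, so countably many steps suffice; step m treats the map of
   index logn 2 m.+1, so that every map is treated infinitely often. *)
Lemma preenvelope_exists M : exists (C : lmodType A) (f : {linear M -> C}),
  (forall j, extends (a j) C) /\ forall N, (forall j, extends (a j) N) -> extends f N.
Proof.
pose ix m : option J := choice.unpickle (logn 2 m.+1).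
pose nx m M' := projT1 (cid (preenvelope_step_opt (ix m) M')).
pose ch := fix ch n : lmodType A := if n is m.+1 then nx m (ch m) else M.
have un n : exists f : {linear ch n -> ch n.+1}, [/\ injective f,
     forall j, ix n = Some j -> forall h : {linear U j -> ch n},
       exists k : {linear V j -> ch n.+1}, forall x, k (a j x) = f (h x)
   & forall N, (forall j, extends (a j) N) -> extends f N].
  exact: (projT2 (cid (preenvelope_step_opt (ix n) (ch n)))).
pose u n := projT1 (cid (un n)).
have uP n : [/\ injective (u n),
     forall j, ix n = Some j -> forall h : {linear U j -> ch n},
       exists k : {linear V j -> ch n.+1}, forall x, k (a j x) = u n (h x)
   & forall N, (forall j, extends (a j) N) -> extends (u n) N].
  exact: (projT2 (cid (un n))).
have u_inj n : injective (u n) by case: (uP n).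
have [C [j [j_inj juE jC]]] := colimit_exists u_inj.
have jle n m (x : ch n) : (n <= m)%N -> exists y, j m y = j n x.
  elim: m => [|m IH]; first by rewrite leqn0 => /eqP n0; case: _ / n0 x => x; exists x.
  rewrite leq_eqVlt => /orP[/eqP nm|]; first by case: _ / nm => //; exists x.
  by rewrite ltnS => /IH[y <-]; exists (u m y).
exists C, (j 0%N); split=> [i h|N eN h].
- have [s sP] := fU i.
  have [n nP] : exists n, forall x, x \in s -> exists y, j n y = h x.
    elim: (s) => [|x t [n nt]]; first by exists 0%N.
    have [m [y yx]] := jC (h x); exists (maxn n m) => z.
    rewrite inE => /orP[/eqP->|/nt[w <-]]; last exact/jle/leq_maxl.
    by rewrite -yx; exact/jle/leq_maxr.
  (* The exponent of 2 makes step m treat the map of index i; the factor $3^n$ ensures $m\ge n$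
     without changing that exponent. *)
  pose m := (2 ^ choice.pickle i * 3 ^ n).-1.
  have m1 : m.+1 = (2 ^ choice.pickle i * 3 ^ n)%N by rewrite prednK // muln_gt0 !expn_gt0.
  have nm : (n <= m)%N.
    rewrite -ltnS m1; apply: leq_trans (ltn_expl n (_ : 1 < 3)%N) _ => //.
    by rewrite leq_pmull // expn_gt0.
  have im : ix m = Some i.
    by rewrite /ix m1 lognM ?expn_gt0 // pfactorK // lognX logn_prime // muln0 addn0 choice.pickleK.
  have hm x : exists y, j m y = h x.
    move: x; apply: (sP (fun x => exists y, j m y = h x)) => [|x y [x' xE] [y' yE]|c x [x' xE]|x xs].
    - by exists 0; rewrite !linear0.
    - by exists (x' + y'); rewrite !linearD xE yE.
    - by exists (c *: x'); rewrite !linearZ /= xE.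
    - by have [y <-] := nP x xs; exact: jle.
  have [h' h'E] := corestrict (j_inj m) hm.
  have [_ /(_ i im h')[k kE] _] := uP m.
  by exists (j m.+1 \o k) => x /=; rewrite kE juE h'E.
- have ext n (g : {linear ch n -> N}) : exists g' : {linear ch n.+1 -> N}, forall x, g' (u n x) = g x.
    by have [_ _ uN] := uP n; exact: uN.
  pose g := fix g n : {linear ch n -> N} :=
    if n is m.+1 return {linear ch n -> N} then projT1 (cid (ext m (g m))) else h.
  have gE n : forall x, g n.+1 (u n x) = g n x := projT2 (cid (ext n (g n))).
  have gle n m (x : ch n) : (n <= m)%N -> exists2 y, j m y = j n x & g m y = g n x.
    elim: m => [|m IH]; first by rewrite leqn0 => /eqP n0; case: _ / n0 x => x; exists x.
    rewrite leq_eqVlt => /orP[/eqP nm|]; first by case: _ / nm => //; exists x.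
    by rewrite ltnS => /IH[y <- <-]; exists (u m y); rewrite ?juE ?gE.
  have g_uniq n m (x : ch n) (y : ch m) : j n x = j m y -> g n x = g m y.
    have [x' <- <-] := gle n (maxn n m) x (leq_maxl _ _).
    have [y' <- <-] := gle m (maxn n m) y (leq_maxr _ _).
    by move/j_inj->.
  have rep c : exists z : N, forall n x, j n x = c -> g n x = z.
    by have [n [x <-]] := jC c; exists (g n x) => m y; exact: g_uniq.
  have [r rE] := choice rep.
  have [|w wE] := @linear_of A C N r.
    move=> c x y; have [n [x' xE]] := jC x; have [m [y' yE]] := jC y.
    have [x1 x1E _] := gle n (maxn n m) x' (leq_maxl _ _).
    have [y1 y1E _] := gle m (maxn n m) y' (leq_maxr _ _).
    rewrite -(rE x (maxn n m) x1) ?x1E // -(rE y (maxn n m) y1) ?y1E // -linearP.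
    by apply/esym/rE; rewrite linearP x1E y1E xE yE.
  by exists w => x; rewrite wE; apply/esym/(rE _ 0%N).
Qed.

End Preenvelope.

(** * The class of a Wakamatsu tilting module *)

Section GenRegular.
Variable R : pzRingType.
Implicit Types T M N K L X : rmodType R.

Lemma gen_star_regularP T : gen_star (right_regular R) T ->
  exists Q : resolution T, (forall i, projective (Q i)) /\ (forall i, fin_gen (Q i)).
Proof.
move=> [Q [aQ _]]; exists Q; split=> i.
- exact: Add_projective (@regular_projective _) (add_Add (aQ i)).
- exact: fin_gen_add (aQ i) (@fin_gen_regular _).
Qed.

Lemma fin_gen_res T (Q : resolution T) n :
  (forall i, fin_gen (Q i)) -> fin_gen (res_syz Q n).
Proof.
move=> fQ; have [i [p [ip _]]] := res_syz_exact Q.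
by have [_ _ p_surj] := ip n; exact: fin_gen_surj p_surj (fQ n).
Qed.

Lemma gen_star_fin_gen T : gen_star (right_regular R) T -> fin_gen T.
Proof. by move=> /gen_star_regularP[Q [_ fQ]]; exact: fin_gen_res 0%N fQ. Qed.

Lemma perpP T N (Q : resolution T) : (forall i, projective (Q i)) ->
  perp T N <-> forall n, ext1_zero (res_syz Q n) N.
Proof.
move=> pQ; split=> [pT n|eQ [//|n] _]; first exact/(Ext_zeroP _ _ pQ)/pT.
exact/(Ext_zeroP _ _ pQ).
Qed.

Lemma perp_Add T T' N : Add T' T -> perp T' N -> perp T N.
Proof. by move=> aT pN [//|n] _; apply: Ext_zero_Add aT _; exact: pN. Qed.

Lemma Gen_star_Add T T' N : Add T T' -> Add T' T -> Gen_star T N -> Gen_star T' N.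
Proof.
move=> TT' T'T [P [aP eP]]; exists P; split=> i; first exact: Add_trans (aP i).
exact: Ext_zero_Add TT' (eP i).
Qed.

Lemma Xbar_Add T T' N : Add T T' -> Add T' T -> Xbar T N -> Xbar T' N.
Proof.
by move=> TT' T'T [pN gN]; split; [exact: perp_Add pN | exact: Gen_star_Add gN].
Qed.

(** The generator sequences have kernels in [D], to which T is orthogonal, so they splice to a
    resolution of the kind [Gen_star] asks for. All maximality arguments rest on this inclusion. *)
Lemma ext_proj_generator_sub (D : rmodType R -> Prop) T N :
  ext_proj_generator D T -> D N -> Xbar T N.
Proof.
move=> [DT pD gD] DN; split=> [i i0|]; first exact: pD.
move: N DN; apply: Gen_star_coind => M /gD[M' [T' [f [g [fg aT DM']]]]].
by exists M', T', f, g; split=> //; apply/Ext_zero1P/pD.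
Qed.

End GenRegular.

(** * Lifting conditions describing [Xbar T] *)

Section Wakamatsu.
Variables (R : pzRingType) (T : rmodType R) (Q : resolution T).
Hypotheses (pQ : forall i, projective (Q i)) (fQ : forall i, fin_gen (Q i)).
Hypothesis eT : forall i, (0 < i)%N -> Ext_zero i T T.
Implicit Types M N K L X : rmodType R.

(** Finitely generated terms of [Q] carry orthogonality from T to infinite sums of copies of T. *)
Lemma perp_of_Add X : Add T X -> perp T X.
Proof.
move=> /AddP[I XI] [//|n] _; apply: Ext_zero_retract_r XI _.
by apply: Ext_zero_dsum pQ fQ _; exact: eT.
Qed.

Lemma Xbar_step N : Xbar T N -> exists K X (f : {linear K -> X}) (g : {linear X -> N}),
  [/\ short_exact f g, Add T X, ext1_zero T K & Xbar T K].
Proof.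
move=> [pN /Gen_star_step[K [T' [f [g [fg aT eK gK]]]]]].
exists K, T', f, g; split=> //; split=> //; apply/(perpP _ pQ).
have [i [p [ip _]]] := res_syz_exact Q.
(* Degree 1 belongs to the choice of the cover; degree n+2 for K comes from degree n+2 for $T'$ and
   degree n+1 for N. *)
case=> [|n] //; apply: (ext1_kernel (ip n.+1) (ip n) fg) => //.
- by move: n.+1; apply/(perpP _ pQ); exact: perp_of_Add.
- by move: n; apply/(perpP _ pQ).
Qed.

Lemma Xbar_self : Xbar T T.
Proof.
split; first exact: eT.
(* T covers itself with zero kernel and all later terms are zero, so the invariant has to admit zero
   modules. *)
apply: (@Gen_star_coind _ _ (fun N => N = T \/ forall x : N, x = 0)); last by left.
move=> N NT; exists (dsum void T).
have z0 (x : dsum void T) : x = 0 by apply: dsum_eqP => -[].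
have e0 : ext1_zero T (dsum void T).
  by apply/Ext_zero1P; apply: perp_of_Add => //; exact: Add_dsum.
case: NT => [->|N0].
  exists T, \0, idfun; split=> //; last by right.
    split=> [x y _|y|y]; [by rewrite (z0 x) (z0 y) | | by exists y].
    by split=> [/= ->|[x <-]] //; exists 0.
  exact/add_Add/add_refl.
exists (dsum void T), idfun, \0; split=> //; last by right.
  split=> // [y|y]; last by exists 0; rewrite (N0 y).
  by split=> // _; exists y.
exact: Add_dsum.
Qed.

Lemma Xbar_ext_proj_generator : ext_proj_generator (Xbar T) T.
Proof.
split; first exact: Xbar_self.
- by move=> X [pX _]; exact: pX.
- move=> M /Xbar_step[K [T' [f [g [fg aT _ XK]]]]].
  by exists K, T', f, g.
Qed.

Variable D : coresolution (right_regular R).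
Hypotheses (aD : forall i, add T (D i)) (eD : forall i, Ext_zero 1 (cores_coker D i) T).
Variables (a : forall n, {linear cores_syz D n -> D n})
  (q : forall n, {linear D n -> cores_syz D n.+1}).
Hypothesis aq : forall n, short_exact (a n) (q n).

Lemma fin_gen_cores n : fin_gen (cores_syz D n).
Proof.
case: n => [|n]; first exact: fin_gen_regular.
have [_ _ q_surj] := aq n; apply: fin_gen_surj q_surj _.
apply: fin_gen_add (aD n) _; exact: fin_gen_res 0%N fQ.
Qed.

Lemma extends_cores_Add n X : Add T X -> extends (a n) X.
Proof.
move=> /AddP[I XI]; apply: extends_retract XI _; apply: extends_dsum.
  exact: fin_gen_cores.
by apply: ext1_extends (aq n) _; exact/Ext_zero1P/eD.
Qed.

Lemma ext1_cores n N : ext1_zero T N -> extends (a n) N -> ext1_zero (cores_syz D n.+1) N.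
Proof.
move=> eN; apply: extends_ext1 (aq n) _.
exact: ext1_Add (add_Add (aD n)) eN.
Qed.

(** The induction ranges over all N because it is applied to the kernel K of a cover $X\to N$:
    extension from $A_n$ to K gives $\mathrm{Ext}^1(A_{n+1},K)=0$, so a map $A_{n+1}\to N$ lifts to
    $X\in\mathrm{Add}(T)$ and extends there. *)
Lemma Xbar_extends_cores n N : Xbar T N -> extends (a n) N.
Proof.
elim: n N => [|n IH] N /Xbar_step[K [T' [f [g [fg aT eK XK]]]]] h.
  have [_ _ g_surj] := fg.
  have [h' h'E] := regular_projective h g_surj.
  have [k kE] := @extends_cores_Add 0%N _ aT h'.
  by exists (g \o k) => x /=; rewrite kE h'E.
have [h' h'E] := ext1_cores eK (IH K XK) fg h.
have [k kE] := @extends_cores_Add n.+1 _ aT h'.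
by exists (g \o k) => x /=; rewrite kE h'E.
Qed.

(** The precover is the evaluation map from the sum of copies of T indexed by $\mathrm{Hom}(T,N)$;
    it need not be surjective. *)
Lemma Add_precover N : exists (T' : rmodType R) (g : {linear T' -> N}), Add T T' /\
  forall X (h : {linear X -> N}), Add T X -> exists k : {linear X -> T'}, forall x, g (k x) = h x.
Proof.
pose I : choiceType := {classic {linear T -> N}}.
have [g gE] := dsum_lift_exists (fun h : I => (h : {linear T -> N})).
exists (dsum I T), g; split=> [|X h /AddP[J [s [p sp]]]]; first exact: Add_dsum.
have [k kE] := dsum_lift_exists (fun j : J =>
  dsum_in ((h \o p \o dsum_in j : {linear T -> N}) : I) : {linear T -> dsum I T}).
exists (k \o s) => x /=; rewrite -[in RHS](sp x).
apply: (dsum_ext (f := g \o k) (g := h \o p)) => j t /=.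
by rewrite kE gE.
Qed.

(* The kernel of an Add(T)-precover of a module satisfying the extension
   conditions satisfies them again. *)
Lemma Gen_star_of_extends N : (forall n, extends (a n) N) -> Gen_star T N.
Proof.
apply: (@Gen_star_coind _ _ (fun N => forall n, extends (a n) N)) => {}N eN.
have [T' [g [aT gP]]] := Add_precover N.
(* The map from $R=A_0$ sending 1 to y extends to $D_0\in\mathrm{add}(T)$, and this extension
   factors through the precover. *)
have g_surj : surj g.
  move=> y.
  have [h hE] : exists h : {linear right_regular R -> N}, forall r : R^c, h r = r *: y.
    by apply: linear_of => c r t; rewrite scalerDl scalerA.
  have [k kE] := eN 0%N h; have [l lE] := gP _ k (add_Add (aD 0%N)).
  by exists (l (a 0%N (1 : R^c))); rewrite lE kE hE scale1r.
have fg := short_exact_ker g_surj.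
exists (kernel g), T', (val : kernel g -> T'), g; split=> //.
  apply: (ext1_precover fg); first by apply/Ext_zero1P; exact: perp_of_Add.
  by move=> h; apply: gP; exact/add_Add/add_refl.
(* The precover property for maps from $D_{n+1}$ supplies the required lifts. *)
move=> n; apply: (extends_kernel (aq n) fg (@extends_cores_Add n _ aT) (eN n.+1)) => h.
exact/gP/add_Add.
Qed.

Lemma XbarP N : Xbar T N <->
  (forall n, ext1_zero (res_syz Q n) N) /\ (forall n, extends (a n) N).
Proof.
split=> [XN|[/(perpP _ pQ) pN eN]]; last by split=> //; exact: Gen_star_of_extends.
split; last by move=> n; exact: Xbar_extends_cores.
by apply/(perpP _ pQ); case: XN.
Qed.

Lemma Xbar_ext1_cores n N : Xbar T N -> ext1_zero (cores_syz D n) N.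
Proof.
move=> XN; case: n => [|n]; first exact/projective_ext1/regular_projective.
by apply: ext1_cores; [case: XN => pN _; exact/Ext_zero1P/pN | exact: Xbar_extends_cores].
Qed.

(** Each closure property is checked on the two families of lifting conditions. For cokernels, a map
    from $A_n$ to N lifts to M because $\mathrm{Ext}^1(A_n,L)=0$, and extends to $D_n$ there. *)
Lemma Xbar_coresolving : coresolving_bar (Xbar T).
Proof.
have [i [p [ip _]]] := res_syz_exact Q.
split=> [M N /summandP MN /XbarP[eN aN]|L M N f g fg|L M N f g fg|E jE].
- apply/XbarP; split=> n; first exact: ext1_retract_r MN (eN n).
  exact: extends_retract MN (aN n).
- move=> XL XN; have [[eL _] [eN _]] := ((XbarP _).1 XL, (XbarP _).1 XN).
  apply/XbarP; split=> n; first exact: ext1_extension fg (eL n) (eN n).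
  apply: ext1_extends (aq n) _.
  exact: ext1_extension fg (@Xbar_ext1_cores n.+1 _ XL) (@Xbar_ext1_cores n.+1 _ XN).
- move=> XL XM; have [[eL _] [eM aM]] := ((XbarP _).1 XL, (XbarP _).1 XM).
  apply/XbarP; split=> n.
    by apply: (ext1_cokernel (ip n) fg) => //; exact: projective_ext1.
  move=> h; have [h' h'E] := @Xbar_ext1_cores n _ XL _ _ _ _ fg h.
  by have [k kE] := aM n h'; exists (g \o k) => x /=; rewrite kE h'E.
- apply/XbarP; split=> n; first exact: injective_ext1.
  exact: ext1_extends (aq n) (injective_ext1 jE).
Qed.

(** $\mathrm{Ext}^1(W_n,N)=0$ is read as extension along $W_{n+1}\to Q_n$, so one countable family
    of injections defines the class: [true] marks syzygies of T, [false] cosyzygies of R. *)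
Lemma Xbar_preenveloping : preenveloping (Xbar T).
Proof.
have [i [p [ip _]]] := res_syz_exact Q.
pose J : countType := (bool * nat)%type.
pose U (j : J) : rmodType R := if j.1 then res_syz Q j.2.+1 else cores_syz D j.2.
pose V (j : J) : rmodType R := if j.1 then Q j.2 else D j.2.
pose b (j : J) : {linear U j -> V j} :=
  match j return {linear U j -> V j} with
  | (true, n) => i n
  | (false, n) => a n
  end.
have b_inj j : injective (b j).
  by case: j => -[] n; [have [i_inj _ _] := ip n; exact: i_inj |
    have [a_inj _ _] := aq n; exact: a_inj].
have fU j : fin_gen (U j) by case: j => -[] n; [exact: fin_gen_res | exact: fin_gen_cores].
have XE N : Xbar T N <-> forall j, extends (b j) N.
  rewrite XbarP; split=> [[eN aN] [[] n]|bN].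
  - exact: ext1_extends (ip n) (eN n).
  - exact: aN.
  split=> n; last exact: (bN (false, n)).
  by apply: (extends_ext1 (ip n)); [exact: projective_ext1 | exact: (bN (true, n))].
move=> M; have [C [f [bC fN]]] := preenvelope_exists b_inj fU M.
exists C, f; split=> [|N h /XE bN]; first exact/XE.
exact: fN.
Qed.

End Wakamatsu.

(** * Maximality, and recovery of add(T) from the class *)

Section WakamatsuClass.
Variable R : pzRingType.
Implicit Types T M N : rmodType R.

Lemma coresolving_bar_subcategory (D : rmodType R -> Prop) :
  coresolving_bar D -> subcategory D.
Proof.
move=> [sD _ _ _] M N MN; apply: sD.
exact/summandP/isomorphic_retract/isomorphic_sym.
Qed.

Lemma Xbar_preenveloping_coresolving T :
  wakamatsu_tilting T -> preenveloping_coresolving (Xbar T).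
Proof.
move=> [eT /gen_star_regularP[Q [pQ fQ]] [D [aD eD]]].
have [a [q aq]] := cores_syz_exact D.
have cX := Xbar_coresolving pQ fQ eT aD eD aq.
split=> //; first exact: coresolving_bar_subcategory.
exact: (Xbar_preenveloping pQ fQ eT aD eD aq).
Qed.

Lemma Xbar_generator T : wakamatsu_tilting T -> ext_proj_generator (Xbar T) T.
Proof.
move=> [eT /gen_star_regularP[Q [pQ fQ]] _].
exact: Xbar_ext_proj_generator pQ fQ eT.
Qed.

Lemma Xbar_maximal T : wakamatsu_tilting T -> maximal_subcat (Xbar T).
Proof.
move=> wT; split; first exact: Xbar_preenveloping_coresolving.
exists T; split; [exact: Xbar_generator | by case: wT |].
by move=> D _ gD _ M; exact: ext_proj_generator_sub gD.
Qed.

(* Both modules generate the class and are Ext-projective in it, so the covers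
   of one by the other split. *)
Lemma Xbar_eq_add T T' : wakamatsu_tilting T -> wakamatsu_tilting T' ->
  (forall M, Xbar T' M <-> Xbar T M) -> add T T'.
Proof.
move=> wT wT' XE; apply: add_of_Add; first by case: wT' => _ /gen_star_fin_gen.
have [XT' pT' _] := Xbar_generator wT'; have [_ _ gT] := Xbar_generator wT.
have [M' [T1 [f [g [fg aT1 XM']]]]] := gT _ ((XE _).1 XT').
apply: Add_retract aT1.
have /Ext_zero1P/(_ _ _ _ _ fg idfun)[s sE] : Ext_zero 1 T' M' by apply: pT' => //; exact/XE.
by exists s, g.
Qed.

End WakamatsuClass.

(** * Enough injectives *)

Section Divisible.
Variable D : zmodType.
Hypothesis D_div : forall n (d : D), (0 < n)%N -> exists e, e *+ n = d.

(** A maximal partial extension, found by Zorn's lemma among graphs in $V\times D$, is total: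
    divisibility provides a value at any missing v. *)
Lemma divisible_extend (U V : zmodType) (f : {additive U -> V}) (h : {additive U -> D}) :
  injective f -> exists k : {additive V -> D}, forall x, k (f x) = h x.
Proof.
move=> f_inj.
(* The last clause asks for the graph of [h] only when G is nonempty, so that the union of the empty
   chain qualifies. A maximal G is nonempty, since that graph would be larger. *)
pose P (G : set (V * D)) := [/\ forall p q, G p -> G q -> G (p - q),
  forall d, G (0, d) -> d = 0 & forall p, G p -> forall x, G (f x, h x)].
have [|G [[GB G0 Gf] Gmax]] := @Zorn_bigcup _ P.
  move=> F FP Ftot; split.
  - move=> p q [X FX Xp] [Y FY Yq].
    have [XY|YX] := Ftot X Y FX FY; [exists Y | exists X] => //.
      by have [XB _ _] := FP Y FY; apply: XB => //; exact: XY.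
    by have [XB _ _] := FP X FX; apply: XB => //; exact: YX.
  - by move=> d [X FX Xd]; have [_ X0 _] := FP X FX; exact: X0.
  - by move=> p [X FX Xp] x; exists X => //; have [_ _ Xf] := FP X FX; exact: Xf Xp x.
have {}Gf x : G (f x, h x).
  have [[p Gp]|G_empty] := pselect (exists p, G p); first exact: Gf Gp x.
  case: (Gmax [set p | exists x, p = (f x, h x)]%classic).
    split=> [p Gp|/(_ (f 0, h 0))]; first by case: G_empty; exists p.
    by move=> GH; apply: G_empty; exists (f 0, h 0); apply: GH; exists 0.
  split.
  - by move=> _ _ [y ->] [z ->]; exists (y - z); rewrite !raddfB.
  - move=> d [y [fy ->]]; rewrite (_ : y = 0) ?raddf0 //.
    by apply: f_inj; rewrite raddf0.
  - by move=> _ _ y; exists y.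
have G00 : G 0 by have := GB _ _ (Gf 0) (Gf 0); rewrite subrr.
have GN p : G p -> G (- p) by move=> Gp; rewrite -[- p]sub0r; exact: GB.
have GD p q : G p -> G q -> G (p + q).
  by move=> Gp Gq; rewrite -[q]opprK; apply: GB => //; exact: GN.
have GMn p n : G p -> G (p *+ n).
  by move=> Gp; elim: n => // n IH; rewrite mulrS; exact: GD.
have GMz p (n : int) : G p -> G (p *~ n).
  by move=> Gp; case: n => n; [exact: GMn | exact/GN/GMn].
have pairMz (x : V) (y : D) (n : int) : (x, y) *~ n = (x *~ n, y *~ n).
  rewrite [LHS]surjective_pairing; congr pair.
    exact: (raddfMz (fst : {additive (V * D)%type -> V})).
  exact: (raddfMz (snd : {additive (V * D)%type -> D})).
have total v : exists d, G (v, d).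
  apply: contrapT => vG.
  (* [e] is the future value at v: if $k v$ is the least positive multiple in the domain, a k-th
     part of the value there; if there is none, 0. *)
  have [e eP] : exists e, forall (n : int) d, G (v *~ n, d) -> d = e *~ n.
    have [ex|noex] := pselect (exists k, `[< (0 < k)%N /\ exists d, G (v *+ k, d) >]); last first.
      exists 0 => n d; rewrite mul0rz.
      have [->|n0 Gd] := eqVneq n 0; first by rewrite mulr0z; exact: G0.
      case: noex; exists `|n|%N; apply/asboolP; split; first by rewrite absz_gt0.
      have [n_ge0|n_lt0] := lerP 0 n.
        by exists d; rewrite -[v *+ _]/(v *~ `|n|%N%:Z) abszE ger0_norm.
      exists (- d); rewrite -[v *+ _]/(v *~ `|n|%N%:Z) abszE ltr0_norm // mulrNz.
      exact: GN Gd.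
    have [k /asboolP[k_gt0 [d0 Gd0]] kmin] := ex_minnP ex.
    have [e eE] := D_div d0 k_gt0.
    exists e => n d Gd.
    have k0 : (k : int) != 0 by rewrite -lt0n in k_gt0 *; case: k k_gt0 {Gd0 kmin eE}.
    pose m := (n %/ k)%Z; pose r := (n %% k)%Z.
    have nE : n = m * k + r := divz_eq n k.
    have Gr : G (v *~ r, d - d0 *~ m).
      have := GB _ _ Gd (GMz _ m Gd0); rewrite pairMz.
      rewrite [X in G X](_ : _ = (v *~ n - v *+ k *~ m, d - d0 *~ m)) // {1}nE mulrzDr.
      by rewrite -[v *+ k]/(v *~ k%:Z) -mulrzA (mulrC k%:Z) addrAC subrr add0r.
    have r0 : r = 0.
      apply/eqP; apply: contraT => rn0.
      have r_ge0 : 0 <= r by exact: modz_ge0.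
      have rk : r < k by rewrite ltz_mod.
      have : (k <= `|r|)%N.
        apply: kmin; apply/asboolP; split; first by rewrite absz_gt0.
        by exists (d - d0 *~ m); rewrite -[v *+ _]/(v *~ `|r|%N%:Z) gez0_abs.
      by rewrite leqNgt -ltz_nat gez0_abs // rk.
    move: Gr; rewrite r0 mulr0z => /G0 /eqP; rewrite subr_eq0 => /eqP ->.
    by rewrite nE r0 addr0 -eE -[e *+ k]/(e *~ k%:Z) -mulrzA mulrC.
  apply: (Gmax [set p | exists q (n : int), G q /\ p = (q.1 + v *~ n, q.2 + e *~ n)]%classic).
    split=> [[x y] Gp|].
      by exists (x, y), 0; split=> //; rewrite !mulr0z !addr0.
    move=> /(_ (v, e)) GH; apply: vG; exists e; apply: GH.
    by exists 0, 1; split=> //; rewrite !mulr1z !add0r.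
  split.
  - move=> _ _ [p [n [Gp ->]]] [q [m [Gq ->]]]; exists (p - q), (n - m).
    split; first exact: GB.
    by rewrite /= !mulrzBr; congr pair; rewrite /= addrACA -opprD.
  - move=> d [[x y] [n [Gq /= [/esym/eqP]]]]; rewrite addr_eq0 => /eqP xE ->.
    move: Gq; rewrite xE -mulrNz => /eP ->.
    by rewrite mulrNz addNr.
  - move=> _ _ x; exists (f x, h x), 0; split=> //.
    by rewrite !mulr0z !addr0.
have G_uniq v d d' : G (v, d) -> G (v, d') -> d = d'.
  move=> Gd Gd'; apply/eqP; rewrite -subr_eq0; apply/eqP/G0.
  by have := GB _ _ Gd Gd'; rewrite [X in G X](_ : _ = (v - v, d - d')) // subrr.
have [k kP] := choice total.
have kB : zmod_morphism k.
  by move=> x y; apply: (G_uniq (x - y)) => //; exact: (GB _ _ (kP x) (kP y)).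
pose K : {additive V -> D} := HB.pack k (GRing.isZmodMorphism.Build V D k kB).
by exists K => x; exact: (G_uniq (f x)).
Qed.

End Divisible.

(* If M = F/K with F free, then M embeds into (F (x) Q)/K. *)
Lemma divisible_embedding (M : zmodType) :
  exists (D : zmodType) (i : {additive M -> D}),
    injective i /\ forall n (d : D), (0 < n)%N -> exists e, e *+ n = d.
Proof.
pose F := dsum M int^o.
pose l : {linear F -> zmodule M} := @dsum_lift int M (zmodule M) (fun x => x).
have [c0 c0E] : exists c : {linear int^o -> zmodule rat}, forall z : int, c z = z%:~R.
  apply: linear_of => a x y; rewrite rmorphD rmorphM /=; congr (_ + _).
  by rewrite mulrzl.
have [c cE] := dsum_map_exists M c0.
have c_inj : injective c.
  apply: inj0 => x cx; apply: dsum_eqP => i.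
  have : c x i = 0 by rewrite cx.
  by rewrite cE c0E => /eqP; rewrite intr_eq0 => /eqP.
pose D : zmodType := cokernel (c \o (val : kernel l -> F)).
pose pi : {linear dsum M (zmodule rat) -> cokernel (c \o (val : kernel l -> F))} :=
  @coker_proj _ _ _ _.
have piP y : pi y = 0 <-> exists2 x, l x = 0 & c x = y.
  rewrite -[X in _ = X](linear0 pi) coker_projP subr0; split=> [[x <-]|[x x0 <-]].
    by exists (val x) => //; exact/eqP/(valP x).
  have xk : x \in ker_pred l by apply/eqP.
  by exists (Kernel xk).
have li x : l (dirac _ x) = x by exact: dsum_lift_dirac.
pose i (x : M) : D := pi (c (dirac _ x)).
have iB : zmod_morphism i.
  move=> x y; apply/eqP; rewrite -subr_eq0 /i -!linearB; apply/eqP/piP.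
  exists (dirac _ (x - y) - (dirac _ x - dirac _ y)) => //.
  by rewrite linearB [X in _ - X]linearB !li subrr.
pose I : {additive M -> D} := HB.pack i (GRing.isZmodMorphism.Build M D i iB).
exists D, I; split=> [x y /= xy|n d n_gt0].
  have /piP[z z0 /c_inj zE] : pi (c (dirac _ (x - y))) = 0.
    by rewrite -[LHS]/(i (x - y)) iB xy subrr.
  by apply/eqP; rewrite -subr_eq0; apply/eqP; rewrite -[LHS]li -zE.
have [y <-] := coker_proj_surj d.
have [m0 m0E] : exists m : {linear zmodule rat -> zmodule rat}, forall z : rat, m z = z / n%:R.
  by apply: linear_of => a x z; rewrite mulrDl /= -[a *: x]/(x *~ a) -mulrzl -mulrA mulrzl.
have [m mE] := dsum_map_exists M m0.
exists (pi (m y)); rewrite -raddfMn; congr (pi _); apply: dsum_eqP => j.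
have [e eE] := dsum_ev (zmodule rat) j.
have -> : (m y *+ n) j = m y j *+ n by rewrite -!eE raddfMn.
by rewrite mE m0E -[LHS]mulr_natr mulfVK // pnatr_eq0 -lt0n.
Qed.

(** * Coinduced modules *)

Section Coinduced.
Variables (A : pzRingType) (D : zmodType).

Definition additive_pred : {pred A -> D} :=
  fun phi => `[< forall x y, phi (x + y) = phi x + phi y >].

Lemma additive_pred_closed : zmod_closed additive_pred.
Proof.
split; first by apply/asboolP => x y; rewrite addr0.
move=> f g /asboolP fD /asboolP gD; apply/asboolP => x y.
by rewrite [LHS](_ : _ = f (x + y) - g (x + y)) // fD gD opprD addrACA.
Qed.

HB.instance Definition _ :=
  GRing.isZmodClosed.Build (A -> D) additive_pred additive_pred_closed.

(** $\mathrm{Hom}_{\mathbb Z}(A,D)$, to be given the left action $(b\phi)(a)=\phi(ab)$. *)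
Record coinduced : Type := Coinduced { coind_fun :> A -> D; _ : coind_fun \in additive_pred }.

HB.instance Definition _ := [isSub for coind_fun].
HB.instance Definition _ := [Choice of coinduced by <:].
HB.instance Definition _ := [SubChoice_isSubZmodule of coinduced by <:].

Lemma coindD (phi : coinduced) x y : phi (x + y) = phi x + phi y.
Proof. by case: phi => phi /= /asboolP. Qed.

Lemma coind_scale_additive (b : A) (phi : coinduced) :
  (fun a => phi (a * b)) \in additive_pred.
Proof. by apply/asboolP => x y; rewrite mulrDl coindD. Qed.

Definition coind_scale b phi : coinduced := Coinduced (coind_scale_additive b phi).

Lemma coind_eqP (phi psi : coinduced) : (forall x, phi x = psi x) -> phi = psi.
Proof. by move=> h; apply/val_inj/funext. Qed.

Lemma coind_scaleA a b phi : coind_scale a (coind_scale b phi) = coind_scale (a * b) phi.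
Proof. by apply: coind_eqP => x /=; rewrite mulrA. Qed.
Lemma coind_scale1 : left_id 1 coind_scale.
Proof. by move=> phi; apply: coind_eqP => x /=; rewrite mulr1. Qed.
Lemma coind_scaleDr : right_distributive coind_scale +%R.
Proof. by move=> a phi psi; apply: coind_eqP. Qed.
Lemma coind_scaleDl phi : {morph coind_scale^~ phi : a b / a + b}.
Proof.
move=> a b; apply: coind_eqP => x /=.
by rewrite mulrDr coindD.
Qed.

HB.instance Definition _ := GRing.Zmodule_isLmodule.Build A coinduced
  coind_scaleA coind_scale1 coind_scaleDr coind_scaleDl.

(** One half of the adjunction $\mathrm{Hom}_A(V,\mathrm{Hom}_{\mathbb
    Z}(A,D))\cong\mathrm{Hom}_{\mathbb Z}(V,D)$. The other half, evaluation at 1, then transports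
    injectivity from D. *)
Lemma coinduced_linear (V : lmodType A) (k : {additive V -> D}) :
  exists K : {linear V -> coinduced}, forall v a, K v a = k (a *: v).
Proof.
have kv v : (fun a => k (a *: v)) \in additive_pred.
  by apply/asboolP => x y; rewrite scalerDl raddfD.
have [|K KE] := @linear_of A V coinduced (fun v => Coinduced (kv v)).
  move=> a x y; apply: coind_eqP => b.
  rewrite [RHS](_ : _ = k ((b * a) *: x) + k (b *: y)) //=.
  by rewrite scalerDr raddfD scalerA.
by exists K => v a; rewrite KE.
Qed.

Lemma coinduced_injective :
  (forall n (d : D), (0 < n)%N -> exists e, e *+ n = d) -> injective_module coinduced.
Proof.
move=> D_div U V f h f_inj.
have hB : zmod_morphism (fun x => h x 1).
  by move=> x y; rewrite linearB.
pose h1 : {additive U -> D} := HB.pack (fun x => h x 1) (GRing.isZmodMorphism.Build U D _ hB).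
have [k kE] := divisible_extend D_div h1 f_inj.
have [K KE] := coinduced_linear k.
exists K => x; apply: coind_eqP => a; rewrite KE -linearZ kE /= linearZ /=.
by rewrite mul1r.
Qed.

End Coinduced.

(** By adjunction an additive embedding into a divisible group becomes a linear map to the coinduced
    module; evaluation at 1 recovers the embedding. *)
Lemma enough_injectives (A : pzRingType) (M : lmodType A) :
  exists (E : lmodType A) (i : {linear M -> E}), injective_module E /\ injective i.
Proof.
have [D [i [i_inj D_div]]] := divisible_embedding M.
have [K KE] := coinduced_linear i.
exists (coinduced A D), K; split; first exact: coinduced_injective.
by move=> x y xy; apply: i_inj; rewrite -[x]scale1r -[y]scale1r -!KE xy.
Qed.

(** * Maximal classes come from Wakamatsu tilting modules *)

Section Generator.
Variable R : pzRingType.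
Implicit Types T M N L : rmodType R.

(** The preenvelope of M lifts to the $\mathrm{Add}(T)$-cover of its target, as the kernel lies in
    [D]. The lift is again a preenvelope, and it is injective because M embeds into an injective
    module, which belongs to [D]. *)
Lemma fin_gen_add_preenvelope (D : rmodType R -> Prop) T M :
  preenveloping_coresolving D -> ext_proj_generator D T ->
  fin_gen M -> (forall N, D N -> ext1_zero M N) ->
  exists n (k : {linear M -> dsum 'I_n T}), injective k /\ forall N, D N -> extends k N.
Proof.
move=> [_ envD [_ _ _ injD]] [_ _ gD] fM eM.
have [X [phi [DX phiP]]] := envD M.
have [M' [T' [f [g [fg /AddP[I [s [p sp]]] DM']]]]] := gD X DX.
have [psi psiE] := eM _ DM' _ _ _ _ fg phi.
have [n [k [r rk]]] := fin_gen_factor (s \o psi) fM.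
have kN N : D N -> extends k N.
  move=> DN h; have [l lE] := phiP N h DN.
  by exists (l \o g \o p \o r) => x /=; rewrite rk /= sp psiE lE.
exists n, k; split=> //.
have [E [i [jE i_inj]]] := enough_injectives M.
have [l lE] := kN E (injD E jE) i.
by move=> x y xy; apply: i_inj; rewrite -!lE xy.
Qed.

Lemma generator_wakamatsu (D : rmodType R -> Prop) T :
  preenveloping_coresolving D -> ext_proj_generator D T ->
  gen_star (right_regular R) T -> wakamatsu_tilting T.
Proof.
move=> envD genD gT; have [DT pT _] := genD; have fT := gen_star_fin_gen gT.
split=> //; first exact: pT.
(* The invariant passes to the cokernel of [k]: T is Ext-projective and all maps to members of [D]
   extend along [k]. *)
apply: (@cogen_star_coind _ _ (fun M => fin_gen M /\ forall N, D N -> ext1_zero M N)).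
  move=> M [fM eM].
  have [n [k [k_inj kN]]] := fin_gen_add_preenvelope envD genD fM eM.
  have kC := short_exact_coker k_inj.
  have eC N : D N -> ext1_zero (cokernel k) N.
    move=> DN; apply: (extends_ext1 kC); last exact: kN.
    by apply: ext1_dsum_l; apply/Ext_zero1P/pT.
  exists (cokernel k), (dsum 'I_n T), k, (@coker_proj _ _ _ k); split=> //.
  - by apply/addP; exists n; exact: retract_refl.
  - exact: eC.
  - split=> //; apply: (fin_gen_surj (@coker_proj_surj _ _ _ k)).
    exact: fin_gen_dsum.
split; first exact: fin_gen_regular.
by move=> N _; exact/projective_ext1/regular_projective.
Qed.

(** [D] lies in [Xbar T], which is itself one of the competitors in the maximality condition. *)
Lemma maximal_subcat_Xbar (D : rmodType R -> Prop) : maximal_subcat D ->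
  exists2 T, wakamatsu_tilting T & D = Xbar T.
Proof.
move=> [envD [T [genD gT Dmax]]]; have wT := generator_wakamatsu envD genD gT.
exists T => //; apply/funext => M; apply/propext; split.
  exact: ext_proj_generator_sub genD.
apply: Dmax; [exact: Xbar_preenveloping_coresolving | exact: Xbar_generator |].
by move=> N; exact: ext_proj_generator_sub genD.
Qed.

End Generator.

(** * Invertible bimodules *)

Section TensorTools.
Variables (B : pzRingType) (X : rmodType B) (Y : lmodType B).

Lemma tensor_sum_pure (t : tensor X Y) :
  exists n (x : 'I_n -> X) (y : 'I_n -> Y), t = \sum_i pure (x i) (y i).
Proof.
suff [s ->] : exists s : seq (X * Y), t = \sum_(p <- s) pure p.1 p.2.
  exists (size s), (fun i => (tnth (in_tuple s) i).1), (fun i => (tnth (in_tuple s) i).2).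
  by rewrite big_tnth.
have [u <-] := tensor_pi_surj t.
elim/freeg_ind_dom0: u => [|k [x y] D _ _ [s IH]]; first by exists [::]; rewrite big_nil raddf0.
have -> : << k *g (x, y) >> = << (x, y) >> *~ k :> {freeg (X * Y)%type}.
  by rewrite freeg_mulz intz.
rewrite raddfD raddfMz /= IH -[tensor_pi _]/(pure x y).
have pureMn n z : pure (z *+ n) y = pure z y *+ n :> tensor X Y.
  elim: n => [|n IHn]; last by rewrite !mulrS pureDl IHn.
  by apply: (addrI (pure 0 y)); rewrite -pureDl !addr0.
have pureN z : pure (- z) y = - pure z y :> tensor X Y.
  by apply: (addrI (pure z y)); rewrite -pureDl !subrr; exact: (pureMn 0%N 0).
exists ((x *~ k, y) :: s); rewrite big_cons /=; congr (_ + _).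
by case: k => n; rewrite /intmul /= ?pureN pureMn.
Qed.

Lemma tensor_ind (D : tensor X Y -> Prop) :
  D 0 -> (forall s t, D s -> D t -> D (s + t)) -> (forall x y, D (pure x y)) ->
  forall t, D t.
Proof.
move=> D0 DD Dp t; have [n [x [y ->]]] := tensor_sum_pure t.
by apply: big_ind.
Qed.

Lemma pure_suml (I : Type) (r : seq I) (F : I -> X) y :
  pure (\sum_(i <- r) F i) y = \sum_(i <- r) pure (F i) y :> tensor X Y.
Proof.
have p0 : pure 0 y = 0 :> tensor X Y.
  by apply: (addrI (pure 0 y)); rewrite -pureDl !addr0.
by apply: (big_morph (fun x => pure x y)) => // x x'; exact: pureDl.
Qed.

Lemma tensor_hom_exists (G : zmodType) (beta : X -> Y -> G) :
  (forall x x' y, beta (x + x') y = beta x y + beta x' y) ->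
  (forall x y y', beta x (y + y') = beta x y + beta x y') ->
  (forall (b : B) x y, beta ((b : B^c) *: x) y = beta x (b *: y)) ->
  exists h : {additive tensor X Y -> G}, forall x y, h (pure x y) = beta x y.
Proof.
move=> bDl bDr bZ.
pose h : {additive tensor X Y -> G} := HB.pack (tensor_lift beta)
  (GRing.isZmodMorphism.Build (tensor X Y) G (tensor_lift beta) (tensor_liftB bDl bDr bZ)).
by exists h => x y; exact: tensor_lift_pure.
Qed.

End TensorTools.

Lemma ltensor_scale_pure (A B : pzRingType) (P : bimodule A B) (Y : lmodType B) a (x : P) (y : Y) :
  a *: (pure x y : ltensor P Y) = pure (lact a x) y.
Proof. exact: tensor_map_pure. Qed.

Lemma rtensor_scale_pure (B C : pzRingType) (X : rmodType B) (N : bimodule B C)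
    (c : C^c) (x : X) (y : bimod_l N) :
  c *: (pure x y : rtensor X N) = pure x (right_mul c y).
Proof. exact: tensor_map_pure. Qed.

Lemma ltensor_ind (A B : pzRingType) (P : bimodule A B) (Y : lmodType B)
    (D : ltensor P Y -> Prop) :
  D 0 -> (forall s t, D s -> D t -> D (s + t)) -> (forall x y, D (pure x y)) ->
  forall t, D t.
Proof. exact: tensor_ind. Qed.

Lemma rtensor_ind (B C : pzRingType) (X : rmodType B) (N : bimodule B C)
    (D : rtensor X N -> Prop) :
  D 0 -> (forall s t, D s -> D t -> D (s + t)) -> (forall x y, D (pure x y)) ->
  forall t, D t.
Proof. exact: tensor_ind. Qed.

Lemma ltensor_hom_exists (A B : pzRingType) (P : bimodule A B) (Y : lmodType B)
    (M : lmodType A) (beta : P -> Y -> M) :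
  (forall x x' y, beta (x + x') y = beta x y + beta x' y) ->
  (forall x y y', beta x (y + y') = beta x y + beta x y') ->
  (forall (b : B) x y, beta ((b : B^c) *: x) y = beta x (b *: y)) ->
  (forall a x y, beta (lact a x) y = a *: beta x y) ->
  exists h : {linear ltensor P Y -> M}, forall x y, h (pure x y) = beta x y.
Proof.
move=> bDl bDr bZ bA; have [h0 hE] := tensor_hom_exists bDl bDr bZ.
pose h : {additive ltensor P Y -> M} := h0.
have [|k kE] := @linear_of A (ltensor P Y) M h; last by exists k => x y; rewrite kE hE.
move=> a s t; rewrite raddfD; congr (_ + _).
elim/(@ltensor_ind A B): s => [|s s' IH IH'|x y].
- by rewrite scaler0 raddf0 scaler0.
- by rewrite scalerDr !raddfD IH IH'.
- by rewrite ltensor_scale_pure !hE bA.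
Qed.

Lemma rtensor_hom_exists (B C : pzRingType) (X : rmodType B) (N : bimodule B C)
    (M : rmodType C) (beta : X -> bimod_l N -> M) :
  (forall x x' y, beta (x + x') y = beta x y + beta x' y) ->
  (forall x y y', beta x (y + y') = beta x y + beta x y') ->
  (forall (b : B) x y, beta ((b : B^c) *: x) y = beta x (b *: y)) ->
  (forall (c : C^c) x y, beta x (right_mul c y) = c *: beta x y) ->
  exists h : {linear rtensor X N -> M}, forall x y, h (pure x y) = beta x y.
Proof.
move=> bDl bDr bZ bC; have [h0 hE] := tensor_hom_exists bDl bDr bZ.
pose h : {additive rtensor X N -> M} := h0.
have [|k kE] := @linear_of _ (rtensor X N) M h; last by exists k => x y; rewrite kE hE.
move=> c s t; rewrite raddfD; congr (_ + _).
elim/(@rtensor_ind B C): s => [|s s' IH IH'|x y].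
- by rewrite scaler0 raddf0 scaler0.
- by rewrite scalerDr !raddfD IH IH'.
- by rewrite rtensor_scale_pure !hE bC.
Qed.

Section FullFaithful.
Variables (A B : pzRingType) (F : functor A B).
Hypothesis eqF : functor_equivalence F.
Variables M M' : lmodType A.

(** [f] is $G h$ conjugated by the unit. By naturality $h$ and $F f$ have the same image under G,
    and the counit makes G faithful. *)
Lemma equivalence_full (h : {linear F M -> F M'}) :
  exists f : {linear M -> M'}, forall y, h y = fmap F f y.
Proof.
case: eqF => G [eta [eps [eta_bij eps_bij eta_nat eps_nat]]].
have [e [etaK eK]] := linear_inverse (eta_bij M').
pose f : {linear M -> M'} := e \o fmap G h \o eta M.
have GE : fmap G h = fmap G (fmap F f).
  apply: linear_ext => y; have [e1 _ e1K] := eta_bij M.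
  by rewrite -(e1K y) -eta_nat /= eK.
exists f => y; have [e2 _ e2K] := eps_bij (F M).
by rewrite -(e2K y) -eps_nat GE eps_nat.
Qed.

Lemma equivalence_faithful (f g : {linear M -> M'}) :
  (forall y, fmap F f y = fmap F g y) -> forall x, f x = g x.
Proof.
case: eqF => G [eta [eps [eta_bij _ eta_nat _]]] /linear_ext fg x.
by apply: (bij_inj (eta_bij M')); rewrite !eta_nat fg.
Qed.

End FullFaithful.

(** * Dual bases of invertible bimodules *)

Section DualBasis.
Variables (A B : pzRingType) (P : bimodule A B).
Hypothesis invP : invertible P.

Lemma ltensor_regular : exists rho : {linear bimod_l P -> ltensor P B^o},
  (forall x, rho x = pure (x : P) (1 : B^o)) /\ injective rho /\ surj rho.
Proof.
have [rho rhoE] : exists rho : {linear bimod_l P -> ltensor P B^o},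
    forall x, rho x = pure (x : P) (1 : B^o).
  apply: linear_of => a x y; rewrite ltensor_scale_pure.
  exact: pureDl.
have [|||k kE] := @tensor_hom_exists B P B^o P (fun x b => (b : B^c) *: x).
- by move=> x x' y; exact: scalerDr.
- by move=> x y y'; exact: scalerDl.
- by move=> b x y; rewrite scalerA.
exists rho; split=> //; split=> [x y|t].
  by rewrite !rhoE => /(congr1 k); rewrite !kE !scale1r.
elim/(@ltensor_ind A B): t => [|s t [x <-] [y <-]|x b].
- by exists 0; rewrite linear0.
- by exists (x + y); rewrite linearD.
- exists ((b : B^c) *: (x : P)); rewrite rhoE pureZ; congr pure.
  by rewrite /GRing.scale /= mulr1.
Qed.

(** By fullness an endomorphism of $P\cong P\otimes_B B$ is induced by one of the left module B,
    that is, by right multiplication by its value at 1. *)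
Lemma invertible_right_mul (phi : {linear bimod_l P -> bimod_l P}) :
  exists b : B, forall x : P, phi x = (b : B^c) *: x.
Proof.
have [rho [rhoE [rho_inj rho_surj]]] := ltensor_regular.
have [|r [rhoK rK]] := @linear_inverse _ _ _ rho.
  have [r rE] := choice rho_surj.
  by exists r => // x; apply: rho_inj; rewrite rE.
have [f fE] := equivalence_full invP (rho \o phi \o r : {linear ltensor P B^o -> ltensor P B^o}).
exists (f (1 : B^o)) => x; apply: rho_inj.
have := fE (rho x); rewrite /= rhoK => ->; rewrite !rhoE pureZ.
rewrite [LHS]tensor_map_pure; congr pure.
by rewrite /GRing.scale /= mulr1.
Qed.

Lemma invertible_right_faithful (b c : B) :
  (forall x : P, (b : B^c) *: x = (c : B^c) *: x) -> b = c.
Proof.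
move=> bc.
have [f fE] : exists f : B -> {linear B^o -> B^o}, forall d (x : B), f d x = x * d.
  suff /choice[f fE] d : exists f : {linear B^o -> B^o}, forall x : B, f x = x * d by exists f.
  by apply: linear_of => a x y; rewrite mulrDl -[a *: x]/(a * x) -mulrA.
rewrite -[b]mul1r -[c]mul1r -!fE.
move: (1 : B); apply: (equivalence_faithful (f := f b) (g := f c) invP) => t.
elim/(@ltensor_ind A B): t => [|s t IH IH'|x y].
- by rewrite !linear0.
- by rewrite !linearD IH IH'.
- rewrite /= /ltensor_map !tensor_map_pure !fE.
  have pE d : pure x (y * d) = pure ((d : B^c) *: ((y : B^c) *: x)) (1 : B^o) :> tensor P B^o.
    by rewrite !pureZ; congr pure; rewrite /GRing.scale /= mulr1.
  by rewrite !pE bc.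
Qed.

(* Writing 1 = eps (sum of p_i (x) n_i), the A-linear forms eps (_ (x) n_i) on P
   turn into the dual basis through B = End_A(P). *)
Lemma invertible_dual_basis : exists n (p : 'I_n -> P) (beta : 'I_n -> {linear P -> (B^c)^o}),
  forall x, x = \sum_i (beta i x : B^c) *: p i.
Proof.
have [G [_ [eps [_ eps_bij _ _]]]] := invP.
have [e _ eK] := eps_bij A^o.
have [n [p [y epE]]] := tensor_sum_pure (e 1 : tensor P (G A^o)).
have /choice[phi phiE] i : exists phi : {linear bimod_l P -> A^o},
    forall x : P, phi x = eps A^o (pure x (y i)).
  by apply: linear_of => a u v; rewrite -linearP ltensor_scale_pure -pureDl.
have one : \sum_i phi i (p i) = 1.
  rewrite -[RHS]eK epE; under eq_bigr do rewrite phiE.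
  by rewrite -[LHS](linear_sum (eps A^o)).
have /choice[b0 b0E] (ix : 'I_n * P) : exists b : B, forall u : P,
    lact (phi ix.1 u : A) ix.2 = (b : B^c) *: u.
  have [psi psiE] : exists psi : {linear bimod_l P -> bimod_l P},
      forall u : P, psi u = lact (phi ix.1 u : A) ix.2.
    apply: linear_of => a u v; rewrite linearP lactDl; congr (_ + _).
    by rewrite -lactA.
  by have [b bE] := invertible_right_mul psi; exists b => u; rewrite -psiE bE.
have /choice[beta betaE] i : exists f : {linear P -> (B^c)^o}, forall x, f x = b0 (i, x).
  apply: linear_of => c x x'; apply: invertible_right_faithful => u.
  rewrite -(b0E (i, c *: x + x')) /= lactDr lactZ.
  by rewrite (b0E (i, x)) (b0E (i, x')) scalerA -scalerDl.
exists n, p, beta => x; rewrite -[LHS]lact1 -one.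
rewrite (big_morph (fun a => lact a x) (fun a b => lactDl a b x) (_ : lact 0 x = 0)).
  by apply: eq_bigr => i _; rewrite betaE (b0E (i, x)).
by apply: (addrI (lact 0 x)); rewrite -lactDl !addr0.
Qed.

(** The dual basis, tensored with N: $x\otimes y\mapsto(\beta_i(x)y)_i$ has the left inverse
    $(y_i)\mapsto\sum_i p_i\otimes y_i$. *)
Lemma invertible_add (C : pzRingType) (N : bimodule B C) : add (N : rmodType C) (rtensor P N).
Proof.
have [n [p [beta betaE]]] := invertible_dual_basis.
have /choice[u uE] i : exists u : {linear rtensor P N -> N},
    forall x (y : bimod_l N), u (pure x y) = lact (beta i x : B) (y : N).
  apply: rtensor_hom_exists.
  - by move=> x x' y; rewrite linearD lactDl.
  - by move=> x y y'; exact: lactDr.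
  - by move=> b x y; rewrite linearZ -lactA.
  - by move=> c x y; exact: lactZ.
have /choice[r rE] i : exists r : {linear N -> rtensor P N},
    forall y : N, r y = pure (p i) (y : bimod_l N).
  by apply: linear_of => c x y; rewrite rtensor_scale_pure -pureDr.
have [s sE] : exists s : {linear rtensor P N -> dsum 'I_n N},
    forall t, s t = \sum_i dsum_in i (u i t).
  apply: linear_of => c x y; rewrite scaler_sumr -big_split; apply: eq_bigr => i _ /=.
  by rewrite !linearP.
have [q qE] := dsum_lift_exists r.
apply/addP; exists n, s, q => t; rewrite sE linear_sum.
under eq_bigr do rewrite qE.
elim/(@rtensor_ind B C): t => [|t t' IH IH'|x y].
- by rewrite big1 // => i _; rewrite !linear0.
- rewrite -[in RHS]IH -[in RHS]IH' -big_split; apply: eq_bigr => i _.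
  by rewrite !linearD.
- under eq_bigr do rewrite uE rE.
  rewrite [in RHS](betaE x) pure_suml; apply: eq_bigr => i _.
  by rewrite pureZ.
Qed.

End DualBasis.

Lemma sim_add (R : pzRingType) (T T' : rmodType R) : sim T T' -> add T' T /\ add T T'.
Proof.
have addI (U V W : rmodType R) : isomorphic V W -> add U W -> add U V.
  move=> /isomorphic_retract VW /addP[n Wn]; apply/addP; exists n.
  exact: retract_trans Wn.
move=> [P [Q [iP iQ TP T'Q]]]; split.
- exact: addI TP (invertible_add iP (endo_bimod T')).
- exact: addI T'Q (invertible_add iQ (endo_bimod T)).
Qed.

(** * Hom bimodules and Morita equivalence *)

Section HomBimodule.
Variables (A : pzRingType) (T U : lmodType A).

(* Hom_A(U, T) as an (End(T), End(U))-bimodule. *)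
Definition homs : Type := {linear U -> T}.

HB.instance Definition _ := gen_eqMixin homs.
HB.instance Definition _ := gen_choiceMixin homs.

Implicit Types f g : {linear U -> T}.
Definition homs_zero : homs := (\0 : {linear U -> T}).
Definition homs_opp f : homs := (\- f : {linear U -> T}).
Definition homs_add f g : homs := (f \+ g : {linear U -> T}).

Lemma homs_addA : associative (homs_add : homs -> homs -> homs).
Proof. by move=> f g h; apply: linear_ext => x /=; rewrite addrA. Qed.
Lemma homs_addC : commutative (homs_add : homs -> homs -> homs).
Proof. by move=> f g; apply: linear_ext => x /=; rewrite addrC. Qed.
Lemma homs_add0 : left_id homs_zero (homs_add : homs -> homs -> homs).
Proof. by move=> f; apply: linear_ext => x /=; rewrite add0r. Qed.
Lemma homs_addN : left_inverse homs_zero (homs_opp : homs -> homs) homs_add.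
Proof. by move=> f; apply: linear_ext => x /=; rewrite addNr. Qed.

HB.instance Definition _ :=
  GRing.isZmodule.Build homs homs_addA homs_addC homs_add0 homs_addN.

Definition homs_scale (s : (endo U)^c) (f : homs) : homs :=
  (f : {linear U -> T}) \o (s : {linear U -> U}).

Lemma homs_scaleA s t f : homs_scale s (homs_scale t f) = homs_scale (s * t) f.
Proof. by apply: linear_ext. Qed.
Lemma homs_scale1 : left_id 1 homs_scale.
Proof. by move=> f; apply: linear_ext. Qed.
Lemma homs_scaleDr : right_distributive homs_scale +%R.
Proof. by move=> s f g; apply: linear_ext. Qed.
Lemma homs_scaleDl f : {morph homs_scale^~ f : s t / s + t}.
Proof. by move=> s t; apply: linear_ext => x; exact: (linearD f). Qed.

HB.instance Definition _ := GRing.Zmodule_isLmodule.Build (endo U)^c homs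
  homs_scaleA homs_scale1 homs_scaleDr homs_scaleDl.

Definition homs_lact (s : endo T) (f : homs) : homs :=
  (s : {linear T -> T}) \o (f : {linear U -> T}).

Lemma homs_lactA s t f : homs_lact s (homs_lact t f) = homs_lact (s * t) f.
Proof. by apply: linear_ext. Qed.
Lemma homs_lact1 f : homs_lact 1 f = f.
Proof. by apply: linear_ext. Qed.
Lemma homs_lactDr s (f g : homs) : homs_lact s (f + g) = homs_lact s f + homs_lact s g.
Proof. by apply: linear_ext => x; exact: (linearD s). Qed.
Lemma homs_lactDl s t f : homs_lact (s + t) f = homs_lact s f + homs_lact t f.
Proof. by apply: linear_ext. Qed.
Lemma homs_lactZ s (t : (endo U)^c) (f : homs) :
  homs_lact s (t *: f) = t *: homs_lact s f.
Proof. by apply: linear_ext. Qed.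

Definition hom_bimod : bimodule (endo T) (endo U) :=
  @Bimodule (endo T) (endo U) homs homs_lact homs_lactA homs_lact1
    homs_lactDr homs_lactDl homs_lactZ.

End HomBimodule.

(** In [homs T U] the target comes first, so composites read like matrix products. *)
Definition homs_comp (A : pzRingType) (T U V : lmodType A) (p : homs T U) (q : homs U V) :
  homs T V := (p : {linear U -> T}) \o (q : {linear V -> U}).

Lemma endo_sumE (A : pzRingType) (T : lmodType A) n (F : 'I_n -> endo T) (t : T) :
  (\sum_i F i : {linear T -> T}) t = \sum_i (F i : {linear T -> T}) t.
Proof. exact: (big_morph (fun f : endo T => (f : {linear T -> T}) t)). Qed.

Section Compose.
Variables (A : pzRingType) (T U : lmodType A).
Local Notation P := (hom_bimod T U).
Local Notation Q := (hom_bimod U T).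

(** A splitting $T\to U^n\to T$ read coordinatewise. The resulting $\alpha_i$ and $\beta_i$ provide
    the explicit inverses in the Morita argument. *)
Lemma add_sum_id : add U T -> exists n (alpha : 'I_n -> homs U T) (beta : 'I_n -> homs T U),
  \sum_i (homs_comp (beta i) (alpha i) : endo T) = 1.
Proof.
move=> /addP[n [s [r rs]]].
have [e eE] := choice (fun i : 'I_n => dsum_ev U i).
exists n, (fun i => e i \o s), (fun i => r \o dsum_in i); apply: linear_ext => t.
rewrite endo_sumE -[RHS]rs.
transitivity (\sum_(i < n) r (dsum_in i (s t i))); first by apply: eq_bigr => i _; rewrite -eE.
rewrite -linear_sum; congr (r _); apply: dsum_eqP => j.
rewrite dsum_sum_evalE (bigD1 j) //= eqxx big1 ?addr0 // => i.
by rewrite eq_sym => /negPf->.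
Qed.

Hypothesis addT : add U T.

(** The inverse is $x\mapsto\sum_i\beta_i\otimes\alpha_i\otimes x$: the endomorphisms $\alpha_i p$
    of U move across the outer tensor sign, leaving $\sum_i\beta_i\alpha_i=1$ acting on p. *)
Lemma homs_comp_iso (N : lmodType (endo T)) :
  exists mu : {linear ltensor P (ltensor Q N) -> N},
    (forall p q x, mu (pure p (pure q x : ltensor Q N)) = (homs_comp p q : endo T) *: x)
    /\ bijective mu.
Proof.
have /choice[m mE] (p : homs T U) : exists m : {additive tensor Q N -> N},
    forall q x, m (pure q x) = (homs_comp p q : endo T) *: x.
  apply: tensor_hom_exists.
  - move=> q q' x; rewrite -scalerDl; congr (_ *: x).
    by apply: linear_ext => t; exact: (linearD p).
  - by move=> q x y; exact: scalerDr.
  - by move=> s q x; rewrite scalerA; congr (_ *: x); apply: linear_ext.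
have mD (p : homs T U) (s t : ltensor Q N) : m p (s + t) = m p s + m p t by exact: raddfD.
have [||||mu muE] := @ltensor_hom_exists _ _ P (ltensor Q N) N (fun p t => m p t).
- move=> p p'; elim/(@ltensor_ind (endo U) (endo T)) => [|s t IH IH'|q x].
  + by rewrite !raddf0 addr0.
  + by rewrite !mD IH IH' addrACA.
  + by rewrite !mE -scalerDl; congr (_ *: x); apply: linear_ext.
- by move=> p s t; exact: mD.
- move=> s p; elim/(@ltensor_ind (endo U) (endo T)) => [|t t' IH IH'|q x].
  + by rewrite scaler0 !raddf0.
  + by rewrite scalerDr !mD IH IH'.
  + by rewrite ltensor_scale_pure !mE; congr (_ *: x); apply: linear_ext.
- move=> s p; elim/(@ltensor_ind (endo U) (endo T)) => [|t t' IH IH'|q x].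
  + by rewrite !raddf0.
  + by rewrite !mD IH IH' scalerDr.
  + by rewrite !mE scalerA; congr (_ *: x); apply: linear_ext.
exists mu; split=> [p q x|]; first by rewrite muE mE.
have [n [alpha [beta ab1]]] := add_sum_id addT.
pose nu (x : N) : ltensor P (ltensor Q N) :=
  \sum_i (pure (beta i : P) (pure (alpha i : Q) x : ltensor Q N) : ltensor P (ltensor Q N)).
have nuD x y : nu (x + y) = nu x + nu y.
  by rewrite -big_split; apply: eq_bigr => i _ /=; rewrite pureDr pureDr.
have nu0 : nu 0 = 0 by apply: (addrI (nu 0)); rewrite -nuD !addr0.
exists nu => [z|x]; last first.
  rewrite linear_sum; under eq_bigr do rewrite muE mE.
  by rewrite -scaler_suml ab1 scale1r.
elim/(@ltensor_ind (endo T) (endo U)): z => [|s t IH IH'|p t]; first by rewrite linear0 nu0.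
  by rewrite linearD nuD IH IH'.
elim/(@ltensor_ind (endo U) (endo T)): t => [|s t IH IH'|q x].
- have -> : pure p (0 : ltensor Q N) = 0 :> ltensor P (ltensor Q N).
    by apply: (addrI (pure p (0 : ltensor Q N))); rewrite -[LHS]pureDr !addr0.
  by rewrite linear0 nu0.
- have -> : pure p (s + t) = pure p s + pure p t :> ltensor P (ltensor Q N) by exact: pureDr.
  by rewrite linearD nuD IH IH'.
rewrite muE mE /nu.
have step i : pure (beta i : P) (pure (alpha i : Q) ((homs_comp p q : endo T) *: x) : ltensor Q N)
    = pure (lact (homs_comp (beta i) (alpha i) : endo T) p : P) (pure q x : ltensor Q N)
    :> ltensor P (ltensor Q N).
  rewrite -pureZ.
  have -> : (homs_comp p q : (endo T)^c) *: (alpha i : Q) =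
      lact (homs_comp (alpha i) p : endo U) (q : Q) by apply: linear_ext.
  rewrite -ltensor_scale_pure -pureZ; congr pure.
  by apply: linear_ext.
under eq_bigr do rewrite step.
rewrite -[LHS]pure_suml; congr pure; rewrite -[RHS](@lact1 _ _ P) -ab1.
apply/esym/(big_morph (fun s => lact s (p : P))); first by move=> s t; exact: lactDl.
by apply: linear_ext.
Qed.

Lemma homs_comp_natural (N N' : lmodType (endo T)) (f : {linear N -> N'})
    (mu : {linear ltensor P (ltensor Q N) -> N})
    (mu' : {linear ltensor P (ltensor Q N') -> N'}) :
  (forall p q x, mu (pure p (pure q x : ltensor Q N)) = (homs_comp p q : endo T) *: x) ->
  (forall p q x, mu' (pure p (pure q x : ltensor Q N')) = (homs_comp p q : endo T) *: x) ->
  forall z, mu' (fmap (tensor_functor P) (fmap (tensor_functor Q) f) z) = f (mu z).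
Proof.
move=> muE mu'E z.
elim/(@ltensor_ind (endo T) (endo U)): z => [|s t IH IH'|p t]; rewrite ?linear0 //.
  by rewrite !linearD IH IH'.
rewrite /= /ltensor_map tensor_map_pure /=.
elim/(@ltensor_ind (endo U) (endo T)): t => [|s t IH IH'|q x].
- have p0 M : pure p (0 : ltensor Q M) = 0 :> ltensor P (ltensor Q M).
    by apply: (addrI (pure p (0 : ltensor Q M))); rewrite -[LHS]pureDr !addr0.
  by rewrite raddf0 !p0 !linear0.
- have pD M s' t' : pure p (s' + t' : ltensor Q M) = pure p s' + pure p t'
    :> ltensor P (ltensor Q M) by exact: pureDr.
  by rewrite raddfD !pD !linearD IH IH'.
by rewrite [ltensor_map _ _]tensor_map_pure mu'E muE linearZ.
Qed.

End Compose.

(** The composition isomorphism over $\mathrm{End}(T)$ is the counit, and the inverse of the one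
    over $\mathrm{End}(U)$ is the unit. *)
Lemma hom_bimod_invertible (A : pzRingType) (T U : lmodType A) :
  add U T -> add T U -> invertible (hom_bimod T U).
Proof.
move=> aT aU.
pose mu N := projT1 (cid (homs_comp_iso aT N)).
have muP N : (forall p q x, mu N (pure p (pure q x : ltensor (hom_bimod U T) N)) =
  (homs_comp p q : endo T) *: x) /\ bijective (mu N) := projT2 (cid (homs_comp_iso aT N)).
pose nu M := projT1 (cid (homs_comp_iso aU M)).
have nuP M : (forall p q x, nu M (pure p (pure q x : ltensor (hom_bimod T U) M)) =
  (homs_comp p q : endo U) *: x) /\ bijective (nu M) := projT2 (cid (homs_comp_iso aU M)).
pose eta M := projT1 (cid (linear_inverse (nuP M).2)).
have etaP M : cancel (nu M) (eta M) /\ cancel (eta M) (nu M) :=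
  projT2 (cid (linear_inverse (nuP M).2)).
exists (tensor_functor (hom_bimod U T)), eta, mu; split=> [M|N|M M' f x|N N' g y].
- by have [nuK etaK] := etaP M; exists (nu M).
- exact: (muP N).2.
- apply: (bij_inj (nuP M').2); rewrite (etaP M').2.
  by rewrite [RHS](homs_comp_natural f (nuP M).1 (nuP M').1) (etaP M).2.
- exact: (homs_comp_natural g (muP N).1 (muP N').1).
Qed.

(** Evaluation $f\otimes u\mapsto f(u)$ is inverted by $t\mapsto\sum_i\beta_i\otimes\alpha_i(t)$. *)
Lemma hom_bimod_eval (R : pzRingType) (T U : rmodType R) : add U T ->
  isomorphic T (rtensor (hom_bimod T U) (endo_bimod U)).
Proof.
move=> /add_sum_id[n [alpha [beta ab1]]]; apply: isomorphic_sym.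
have [||||h hE] := @rtensor_hom_exists _ _ (hom_bimod T U) (endo_bimod U) T
  (fun f u => (f : {linear U -> T}) u).
- by [].
- by move=> f u v; exact: (linearD (f : {linear U -> T})).
- by [].
- by move=> c f u; exact: (linearZ_LR (f : {linear U -> T})).
exists h.
pose k (t : T) : rtensor (hom_bimod T U) (endo_bimod U) :=
  \sum_i (pure (beta i : hom_bimod T U) ((alpha i : {linear T -> U}) t : bimod_l (endo_bimod U))
    : rtensor (hom_bimod T U) (endo_bimod U)).
have kD x y : k (x + y) = k x + k y.
  rewrite -big_split; apply: eq_bigr => i _ /=.
  by rewrite linearD; exact: pureDr.
have k0 : k 0 = 0 by apply: (addrI (k 0)); rewrite -kD !addr0.
exists k => [z|t]; last first.
  rewrite linear_sum; under eq_bigr do rewrite hE.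
  by have /(congr1 (fun f : endo T => (f : {linear T -> T}) t)) := ab1; rewrite endo_sumE.
elim/(@rtensor_ind (endo U) R): z => [|s t IH IH'|f u].
- by rewrite linear0 k0.
- by rewrite linearD kD IH IH'.
rewrite hE /k.
have step i : pure (beta i : hom_bimod T U) ((alpha i : {linear T -> U}) ((f : {linear U -> T}) u)
    : bimod_l (endo_bimod U)) =
    pure (lact (homs_comp (beta i) (alpha i) : endo T) f : hom_bimod T U) u
    :> rtensor (hom_bimod T U) (endo_bimod U).
  rewrite -[X in pure _ X]/((homs_comp (alpha i) f : endo U) *: u) -pureZ.
  by congr pure; apply: linear_ext.
under eq_bigr do rewrite step.
rewrite -[LHS]pure_suml; congr pure; rewrite -[RHS](@lact1 _ _ (hom_bimod T U)) -ab1.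
apply/esym/(big_morph (fun s => lact s (f : hom_bimod T U))); first by move=> s t; exact: lactDl.
by apply: linear_ext.
Qed.

Lemma add_sim (R : pzRingType) (T U : rmodType R) : add U T -> add T U -> sim T U.
Proof.
move=> aT aU; exists (hom_bimod T U), (hom_bimod U T).
split; [exact: hom_bimod_invertible | exact: hom_bimod_invertible |
  exact: hom_bimod_eval | exact: hom_bimod_eval].
Qed.

(** * The correspondence *)

Lemma sim_XbarP (R : pzRingType) (T T' : rmodType R) :
  wakamatsu_tilting T -> wakamatsu_tilting T' -> sim T T' <-> Xbar T = Xbar T'.
Proof.
move=> wT wT'; split=> [/sim_add[/add_Add aT /add_Add aT']|XE].
  by apply/funext => M; apply/propext; split; exact: Xbar_Add.
by apply: add_sim; apply: Xbar_eq_add => //; rewrite XE.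
Qed.

Lemma sim_class_XbarP (R : pzRingType) (T T' : rmodType R) :
  wakamatsu_tilting T -> wakamatsu_tilting T' ->
  sim_class T = sim_class T' <-> Xbar T = Xbar T'.
Proof.
move=> wT wT'; split=> [E|E].
  have : sim_class T' T by rewrite -E; split=> //; exact/sim_XbarP.
  by case=> _ /(sim_XbarP wT' wT).
apply/funext => M; apply/propext.
by split=> -[wM] /sim_XbarP ME; split=> //; apply/sim_XbarP; rewrite // -ME // E.
Qed.

Theorem theorem1p1 (R : pzRingType) :
  exists Phi : tilting_classes R -> maximal_subcats R,
    bijective Phi /\
    forall (T : rmodType R) (hT : wakamatsu_tilting T),
      sval (Phi (class_of hT)) = Xbar T.
Proof.
have sig_eq (X : Type) (P : X -> Prop) (u v : {x | P x}) : sval u = sval v -> u = v.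
  by case: u v => x Px [y Py] /= xy; case: _ / xy Py => Py; congr exist; exact: Prop_irrelevance.
(* The map is defined on a chosen representative; [PhiE] shows that the value does not depend on the
   choice. *)
pose rep (E : tilting_classes R) : rmodType R := projT1 (cid (svalP E)).
have repP E : wakamatsu_tilting (rep E) /\ sval E = sim_class (rep E).
  exact: (projT2 (cid (svalP E))).
pose Phi E : maximal_subcats R := exist _ (Xbar (rep E)) (Xbar_maximal (repP E).1).
have PhiE T (hT : wakamatsu_tilting T) : sval (Phi (class_of hT)) = Xbar T.
  have [wR RE] := repP (class_of hT).
  by apply/(sim_class_XbarP wR hT); rewrite -RE.
have PsiE (C : maximal_subcats R) : exists E, Phi E = C.
  have [T wT CE] := maximal_subcat_Xbar (svalP C).
  by exists (class_of wT); apply: sig_eq; rewrite PhiE CE.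
have [Psi PsiK] := choice PsiE.
have Phi_inj : injective Phi.
  move=> E E' /(congr1 sval) /= XE; apply: sig_eq.
  have [[wE ->] [wE' ->]] := (repP E, repP E').
  exact/sim_class_XbarP.
exists Phi; split=> //; exists Psi => // E.
by apply: Phi_inj; rewrite PsiK.
Qed.
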